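(* Let $\phi\in(0,\pi/2)$, let $\Omega_\phi=\{w\in\mathbb{C}:|w|\le1\}\setminus\{\pm i,\pm e^{i\phi},\pm e^{-i\phi}\}$, and let $(X,Y,Z):\Omega_\phi\to\mathbb{R}^3$ be the functions defined in the context. There exists a well-defined map $$G:(\mathbb{C}\cup\{\infty\})\setminus\{\pm i,\pm e^{i\phi},\pm e^{-i\phi}\}\to\mathbb{R}^3/\langle\mathsf{T}_{2\pi}\rangle,\qquad w\mapsto(Y,X,Z)(w),$$ that extends the map $F:\Omega_\phi\to\mathbb{R}^3$, $F(w)=(Y,X,Z)(w)$, once we quotient by $\mathsf{T}_{2\pi}$ in the target, and is an embedding, whose image we denote by $\widetilde\Gamma_\phi$. Moreover: (i) $\widetilde\Gamma_\phi$ is a complete minimal surface in the quotient $\mathbb{R}^3/\langle\mathsf{T}_{2\pi}\rangle$, invariant under the reflection through $\{x=0\}$; (ii) $\widetilde\Gamma_\phi$ has genus $0$ and exactly six ends, with two ends asymptotic to the cylinder $\{y=0\}$ and the remaining four ends asymptotic to $\{y=\pm b^{\mathrm{tow}}_\vartheta+x\tan\vartheta\}$ and $\{y=\pm b^{\mathrm{tow}}_\vartheta-x\tan\vartheta\}$; (iii) $\widetilde\Gamma_\phi$ meets $\{x=0\}\cap\{z=\pi/2\}$ at a single point, which lies in $\{y>0\}$.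
   Context: $(x,y,z)$ denote Cartesian coordinates on $\mathbb{R}^3$ and also the induced quotient coordinates on $\mathbb{R}^3/\langle\mathsf{T}_{2\pi}\rangle$, where $\mathsf{T}_{2\pi}(x,y,z)=(x,y,z+2\pi)$; vertical planes become cylinders in the quotient. The angle $\vartheta\in(0,\pi/2)$ is determined by $\cos\vartheta=1-\sin\phi$, and $$X(w)=\sin\vartheta\,\log\frac{|w+e^{i\phi}||w+e^{-i\phi}|}{|w-e^{i\phi}||w-e^{-i\phi}|},\qquad Y(w)=\log\frac{|w-i|}{|w+i|}+\cos\vartheta\,\log\frac{|w-e^{i\phi}||w+e^{-i\phi}|}{|w+e^{i\phi}||w-e^{-i\phi}|},$$ $$Z(w)=\sum_{\epsilon_1,\epsilon_2=\pm1}\epsilon_1\epsilon_2\,\mathrm{Arg}\frac{\epsilon_1e^{\epsilon_2i\phi}-w}{\epsilon_1e^{\epsilon_2i\phi}}-\sum_{\epsilon=\pm1}\epsilon\,\mathrm{Arg}\frac{\epsilon i-w}{\epsilon i},$$ with $\mathrm{Arg}\in(-\pi,\pi]$; $$b^{\mathrm{tow}}_\vartheta=\bigl(\sin\vartheta-\tfrac12\tan\vartheta\bigr)\log(2\sec\vartheta-1)-2\sin\vartheta\,\log(\sec\vartheta-1).$$ An end is the image of a small connected punctured neighborhood of one of the six punctures $w_0$; it is asymptotic to (the quotient of) a plane $\Pi$ if, as $w\to w_0$, the image point leaves every compact set and its distance to $\Pi$ tends to $0$. *)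

(* Defs.v *)
From HB Require Import structures.
From mathcomp Require Import all_boot all_order all_algebra complex generic_quotient.
From mathcomp Require Import all_classical all_reals all_analysis.

Set Implicit Arguments.
Unset Strict Implicit.
Unset Printing Implicit Defensive.

Import Order.TTheory GRing.Theory Num.Theory numFieldNormedType.Exports.

Local Open Scope classical_set_scope.
Local Open Scope complex_scope.
Local Open Scope ring_scope.

(* The alias [^o] is what carries the topology of the complex plane. *)
Notation Cplane R := (R[i]^o)%type.
Notation rsphere R := (one_point_compactification (Cplane R)).

Section Euclidean.
Context {R : realType}.

Definition vec3 (x y z : R) : 'rV[R]_3 := \row_(j < 3) [:: x; y; z]`_j.
Definition cx (p : 'rV[R]_3) : R := p 0 0.
Definition cy (p : 'rV[R]_3) : R := p 0 1.
Definition cz (p : 'rV[R]_3) : R := p 0 2.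

Definition dot (u v : 'rV[R]_3) : R := \sum_j u 0 j * v 0 j.

(* The library norm on ['rV[R]_3] is the sup norm; this is the Euclidean one. *)
Definition enorm (u : 'rV[R]_3) : R := Num.sqrt (dot u u).

(* Indices are taken modulo 3. *)
Definition cross (u v : 'rV[R]_3) : 'rV[R]_3 :=
  \row_(k < 3) (u 0 (k + 1) * v 0 (k + 2) - u 0 (k + 2) * v 0 (k + 1)).

End Euclidean.

Section Quotient.
Context {R : realType}.

(* [p] and [q] are in the same orbit of the group generated by
   (x,y,z) |-> (x,y,z+2pi). *)
Definition orbit_rel (p q : 'rV[R]_3) : bool :=
  `[< exists k : int, q = p + vec3 0 0 (2 * pi) *~ k >].

Lemma orbit_rel_refl : reflexive orbit_rel.
Proof. by move=> p; apply/asboolP; exists 0; rewrite mulr0z addr0. Qed.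

Lemma orbit_rel_sym : symmetric orbit_rel.
Proof.
move=> p q; apply/asboolP/asboolP => -[k ->]; exists (- k);
by rewrite mulrNz addrK.
Qed.

Lemma orbit_rel_trans : transitive orbit_rel.
Proof.
move=> q p r /asboolP[k ->] /asboolP[l ->]; apply/asboolP; exists (k + l).
by rewrite mulrzDr addrA.
Qed.

Canonical orbit_equiv_rel :=
  EquivRel orbit_rel orbit_rel_refl orbit_rel_sym orbit_rel_trans.

End Quotient.

Notation quot3 R := (quotient_topology {eq_quot (@orbit_equiv_rel R)}%qT).

Section QuotientGeometry.
Context {R : realType}.

Definition qproj (p : 'rV[R]_3) : quot3 R :=
  (\pi_(quot3 R) p)%qT.

(* The subset of the quotient cut out by a condition on the coordinates. *)
Definition locus (P : 'rV[R]_3 -> Prop) : set (quot3 R) := qproj @` [set p | P p].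

Definition dist_to (q : quot3 R) (A : set (quot3 R)) : R :=
  inf [set d | exists a b, [/\ qproj a = q, A (qproj b) & d = enorm (a - b)]].

Definition invariant_reflection_x (M : set (quot3 R)) : Prop :=
  forall p, M (qproj (vec3 (- cx p) (cy p) (cz p))) <-> M (qproj p).

End QuotientGeometry.

Definition top_embedding {S T : topologicalType} (D : set S) (h : S -> T) : Prop :=
  [/\ {in D &, injective h}, {within D, continuous h} &
      forall V : set S, open V ->
        exists W : set T, open W /\ h @` (D `&` V) = W `&` h @` D].

Section Surfaces.
Context {R : realType}.
Implicit Types (f : 'rV[R]_2 -> 'rV[R]_3) (U : set 'rV[R]_2).

Definition partial (i : 'I_2) f : 'rV[R]_2 -> 'rV[R]_3 := 'D_(delta_mx 0 i) f.

Fixpoint Ck (k : nat) U f : Prop :=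
  (forall u, U u -> {for u, continuous f}) /\
  if k is k'.+1 then
    forall i, (forall u, U u -> derivable f u (delta_mx 0 i)) /\
              Ck k' U (partial i f)
  else True.

Definition smooth U f : Prop := forall k, Ck k U f.

Definition immersed U f : Prop :=
  forall u, U u -> row_free (\matrix_(i < 2) partial i f u).

(* H = (eG - 2fF + gE) / (2(EG - F^2)) in terms of the first and second
   fundamental forms. *)
Definition mean_curvature f (u : 'rV[R]_2) : R :=
  let fu := partial 0 f u in
  let fv := partial 1 f u in
  let n := (enorm (cross fu fv))^-1 *: cross fu fv in
  let E := dot fu fu in let F := dot fu fv in let G := dot fv fv in
  let e := dot (partial 0 (partial 0 f) u) n in
  let f' := dot (partial 1 (partial 0 f) u) n in
  let g := dot (partial 1 (partial 1 f) u) n in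
  (e * G - 2 * f' * F + g * E) / (2 * (E * G - F ^+ 2)).

(* Smoothness of maps into the quotient is read off local lifts, [qproj] being
   a local diffeomorphism. *)
Definition smooth_immersion U (h : 'rV[R]_2 -> quot3 R) : Prop :=
  forall u, U u -> exists (V : set 'rV[R]_2) f,
    [/\ open V, V u, V `<=` U, smooth V f /\ immersed V f &
        forall v, V v -> h v = qproj (f v)].

(* The two standard charts of the Riemann sphere, w and 1/w. *)
Definition cplx (u : 'rV[R]_2) : Cplane R := u 0 0 +i* u 0 1.
Definition chart0 (u : 'rV[R]_2) : rsphere R := Some (cplx u).
Definition chart_infty (u : 'rV[R]_2) : rsphere R :=
  if cplx u == 0 then None else Some (cplx u)^-1.

Definition smooth_embedding (D : set (rsphere R)) (G : rsphere R -> quot3 R) : Prop :=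
  [/\ top_embedding D G,
      smooth_immersion (chart0 @^-1` D) (G \o chart0) &
      smooth_immersion (chart_infty @^-1` D) (G \o chart_infty)].

(* An embedded surface without boundary, covered by local parametrizations,
   whose mean curvature vanishes identically. *)
Definition minimal_surface (M : set (quot3 R)) : Prop :=
  forall p, M p -> exists (U : set 'rV[R]_2) f,
    [/\ open U /\ smooth U f, immersed U f /\ top_embedding U (qproj \o f),
        (exists W : set (quot3 R), open W /\ (qproj \o f) @` U = W `&` M),
        ((qproj \o f) @` U) p &
        forall u, U u -> mean_curvature f u = 0].

Definition C1_curve (c : R -> 'rV[R]_3) : Prop :=
  (forall t, derivable c t 1) /\ continuous (derive1 c).

Definition arc_length (c : R -> 'rV[R]_3) : \bar R :=
  (\int[lebesgue_measure]_(t in `[0%R, 1%R]) (enorm (derive1 c t))%:E)%E.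

(* A piecewise C^1 path in [M] from [p] to [q], as a list of C^1 arcs in
   Euclidean space, each restricted to [0,1], whose projections fit together. *)
Fixpoint path_in (M : set (quot3 R)) (p q : quot3 R)
    (s : seq (R -> 'rV[R]_3)) : Prop :=
  if s is c :: s' then
    [/\ C1_curve c, forall t, 0 <= t <= 1 -> M (qproj (c t)), qproj (c 0) = p &
        path_in M (qproj (c 1)) q s']
  else p = q.

Definition intrinsic_dist (M : set (quot3 R)) (p q : quot3 R) : \bar R :=
  ereal_inf [set (\sum_(c <- s) arc_length c)%E | s in path_in M p q].

Definition complete_surface (M : set (quot3 R)) : Prop :=
  forall u : nat -> quot3 R, (forall n, M (u n)) ->
  (forall e : R, 0 < e -> exists N, forall m n, (N <= m)%N -> (N <= n)%N ->
    (intrinsic_dist M (u m) (u n) < e%:E)%E) ->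
  exists2 p, M p & (fun n => intrinsic_dist M (u n) p) @ \oo --> 0%E.

(* Genus 0 with [k] ends: a sphere with [k] punctures. *)
Definition genus0_with_ends (M : set (quot3 R)) (k : nat) : Prop :=
  exists (s : seq (rsphere R)) (h : rsphere R -> quot3 R),
    [/\ uniq s, size s = k, top_embedding (~` [set` s]) h &
        h @` (~` [set` s]) = M].

Definition end_asymptotic (G : rsphere R -> quot3 R) (w0 : rsphere R)
    (A : set (quot3 R)) : Prop :=
  (forall K : set (quot3 R), compact K -> \forall w \near w0^', ~ K (G w)) /\
  dist_to (G w) A @[w --> w0^'] --> (0 : R).

End Surfaces.

Section Tower.
Context {R : realType}.

Definition cabs (w : R[i]) : R := complex.Re `|w|.
Definition expi (t : R) : R[i] := cos t +i* sin t.

(* The argument in ]-pi, pi] of a nonzero complex number. *)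
Definition Arg (w : R[i]) : R :=
  if 0 <= complex.Im w then acos (complex.Re w / cabs w)
  else - acos (complex.Re w / cabs w).

Definition towX (phi theta : R) (w : R[i]) : R :=
  sin theta * ln ((cabs (w + expi phi) * cabs (w + expi (- phi)))
                  / (cabs (w - expi phi) * cabs (w - expi (- phi)))).

Definition towY (phi theta : R) (w : R[i]) : R :=
  ln (cabs (w - 'i) / cabs (w + 'i))
  + cos theta * ln ((cabs (w - expi phi) * cabs (w + expi (- phi)))
                    / (cabs (w + expi phi) * cabs (w - expi (- phi)))).

Definition signs : seq R := [:: 1; -1].

Definition towZ (phi : R) (w : R[i]) : R :=
  \sum_(e1 <- signs) \sum_(e2 <- signs)
     e1 * e2 * Arg ((e1%:C * expi (e2 * phi) - w) / (e1%:C * expi (e2 * phi)))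
  - \sum_(e <- signs) e * Arg ((e%:C * 'i - w) / (e%:C * 'i)).

(* The first coordinate is [towY] and the second is [towX]. *)
Definition towF (phi theta : R) (w : R[i]) : 'rV[R]_3 :=
  vec3 (towY phi theta w) (towX phi theta w) (towZ phi w).

Definition punctures (phi : R) : seq R[i] :=
  [:: 'i; - 'i; expi phi; - expi phi; expi (- phi); - expi (- phi)].

Definition punctured_disc (phi : R) : set R[i] :=
  [set w | cabs w <= 1] `\` [set` punctures phi].

Definition punctured_sphere (phi : R) : set (rsphere R) :=
  ~` (Some @` [set` punctures phi]).

Definition btow (theta : R) : R :=
  (sin theta - 2^-1 * tan theta) * ln (2 * (cos theta)^-1 - 1)
  - 2 * sin theta * ln ((cos theta)^-1 - 1).

End Tower.

(* Main.v *)
(** In the stereographic coordinates a = 2 Re w/(1+|w|^2), b = 2 Im w/(1+|w|^2),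
    with c = cos phi, s = sin phi, one has |w - e^(i phi)|^2 = (1+|w|^2)(1-ac-bs).
    Hence, with lr x = ln((1+x)/(1-x)), P = lr(ac+bs) and Q = lr(ac-bs),
        2X = sin theta (P+Q),   2Y = - lr b + cos theta (Q-P).
    If two points have the same (X,Y) and b1 < b2, then Q-P increases while P+Q
    is constant, so ac-bs increases and ac+bs decreases, that is b1 > b2.  This
    contradiction shows that (X,Y) determines w up to w <-> 1/conj w.
    Moreover e^(iZ) = R/|R| for a rational function R with
    R(1/conj w) = - conj(R(w)) and Re R a positive multiple of 1-|w|^2, so Z
    separates the two sheets.  The map is given by Weierstrass data that have
    poles only at the punctures, and the sum of their squares vanishes because
    cos theta = 1 - sin phi.  The relation G(1/w) = (-Y, X, pi - Z)(w) gives the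
    chart at infinity.  The logarithms blow up at the punctures, so G is proper,
    which turns injectivity into embeddedness and yields completeness. *)

Require Import Defs.
From mathcomp Require Import all_boot all_order all_algebra complex generic_quotient.
From mathcomp Require Import all_classical all_reals all_analysis.
From mathcomp Require Import zify ring lra measurable_realfun.

Set Implicit Arguments.
Unset Strict Implicit.
Unset Printing Implicit Defensive.

Import Order.TTheory GRing.Theory Num.Theory numFieldNormedType.Exports.

Local Open Scope classical_set_scope.
Local Open Scope complex_scope.
Local Open Scope ring_scope.


(** The function Z is a sum of principal arguments and jumps across their cuts, so its formula
    cannot be differentiated there. Globally only e^(iZ) is used, because the quotient sees the
    third coordinate through [expi] alone. Around each base point w0 a smooth lift replaces Z by a
    constant plus the arctangent branch of arg(R(w)/R(w0)), valid where this quotient has positive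
    real part. A sign a = 1 or a = -1 lets one family of lifts serve both charts of the sphere. The
    slopes of the asymptotic planes come from a cancellation: at each puncture one of X, X - Y tan
    theta, X + Y tan theta loses its logarithmic singularity, and its value there is the offset 0 or
    +-b^tow. Completeness needs no estimate of lengths along the ends: x and y are 1-Lipschitz for
    the intrinsic distance, which confines a Cauchy sequence to a compact sublevel of |x| + |y|. *)

(** * Modulus, polar form and the kernel of t -> e^(it) *)

Section ComplexArithmetic.
Context {R : realType}.
Implicit Types (z w : R[i]) (t : R).

Definition nsq z : R := complex.Re z ^+ 2 + complex.Im z ^+ 2.

Lemma cabsE z : cabs z = Num.sqrt (nsq z).
Proof. by rewrite /cabs normc_def. Qed.

Lemma cabsM z w : cabs (z * w) = cabs z * cabs w.
Proof. by rewrite /cabs normrM !normc_def /= mulr0 subr0. Qed.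

Lemma cabsV z : cabs z^-1 = (cabs z)^-1.
Proof.
have cE (x : R[i]) : cabs x = Normc.normc x by rewrite cabsE; case: x.
by rewrite !cE Normc.normcV.
Qed.

Lemma cabs_ge0 z : 0 <= cabs z.
Proof. by rewrite cabsE sqrtr_ge0. Qed.

Lemma cabs_gt0 z : (0 < cabs z) = (z != 0).
Proof. by rewrite -[z != 0]normr_gt0 /cabs normc_def ltcR. Qed.

Lemma norm_cabs z : `|z| = (cabs z)%:C.
Proof. by rewrite /cabs normc_def. Qed.

Lemma nsq_ge0 z : 0 <= nsq z.
Proof. by rewrite addr_ge0 ?sqr_ge0. Qed.

Lemma nsq_gt0 z : (0 < nsq z) = (z != 0).
Proof. by rewrite -cabs_gt0 cabsE sqrtr_gt0. Qed.

Lemma cabs_sqr z : cabs z ^+ 2 = nsq z.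
Proof. by rewrite cabsE sqr_sqrtr ?nsq_ge0. Qed.

Lemma nsqM z w : nsq (z * w) = nsq z * nsq w.
Proof. by rewrite -!cabs_sqr cabsM exprMn. Qed.

Lemma nsqV z : nsq z^-1 = (nsq z)^-1.
Proof. by rewrite -!cabs_sqr cabsV exprVn. Qed.

Lemma complex_eqP z w :
  complex.Re z = complex.Re w -> complex.Im z = complex.Im w -> z = w.
Proof. by case: z w => [a b] [c d] /= -> ->. Qed.

Lemma expiD s t : expi (s + t) = expi s * expi t.
Proof. by rewrite /expi cosD sinD; apply: complex_eqP => //=; ring. Qed.

Lemma expi0 : expi 0 = 1 :> R[i].
Proof. by rewrite /expi cos0 sin0. Qed.

Lemma cabs_expi t : cabs (expi t) = 1.
Proof. by rewrite cabsE /nsq /= cos2Dsin2 sqrtr1. Qed.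

Lemma expi_neq0 t : expi t != 0.
Proof. by rewrite -cabs_gt0 cabs_expi. Qed.

Lemma expiN t : expi (- t) = (expi t)^-1.
Proof. by apply: (mulfI (expi_neq0 t)); rewrite -expiD subrr expi0 mulfV ?expi_neq0. Qed.

Lemma expi_Arg z : z != 0 -> expi (Arg z) = z / (cabs z)%:C.
Proof.
rewrite -cabs_gt0 => z0; set x := complex.Re z; set y := complex.Im z.
have z1 : (x / cabs z) ^+ 2 + (y / cabs z) ^+ 2 = 1.
  by rewrite !expr_div_n -mulrDl -/(nsq z) -cabs_sqr divff// expf_neq0// gt_eqF.
have xb : -1 <= x / cabs z <= 1.
  by rewrite -ler_norml -(@ler_pXn2r _ 2)// ?nnegrE// expr1n real_normK ?num_real// -z1 lerDl sqr_ge0.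
have -> : z / (cabs z)%:C = (x / cabs z) +i* (y / cabs z).
  rewrite /x /y; case: z z0 {x y z1 xb} => a b z0 /=.
  by rewrite -fmorphV; apply: complex_eqP => /=; ring.
have s : Num.sqrt (1 - (x / cabs z) ^+ 2) = `|y / cabs z|.
  by rewrite -z1 addrAC subrr add0r sqrtr_sqr.
rewrite /expi /Arg -/x -/y; case: ifPn => y0.
  by rewrite acosK// sin_acos// s ger0_norm// divr_ge0// ltW.
rewrite cosN sinN acosK// sin_acos// s ltr0_norm ?opprK//.
by rewrite -ltNge in y0; rewrite pmulr_llt0 ?invr_gt0.
Qed.

Lemma expi_eq s t : expi s = expi t -> exists k : int, t = s + (2 * pi) *~ k.
Proof.
move=> est; suff [k kE] : exists k : int, t - s = (2 * pi) *~ k.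
  by exists k; rewrite -kE addrC subrK.
have : expi (t - s) = 1 by rewrite expiD expiN est mulfV ?expi_neq0.
move: (t - s) => {est s}t {}/[dup] - [ct st].
have pi0 : (0 : R) < 2 * pi by rewrite mulr_gt0// pi_gt0.
(* Removing k full turns leaves a remainder r in [0, 2 pi). If r <= pi, injectivity of cosine on
   [0, pi] gives r = 0; if r > pi, then sin (r - pi) > 0 contradicts sin r = 0. *)
set k := Num.floor (t / (2 * pi)) => _.
have kP (f : R -> R) (fp : periodic f (pi *+ 2)) x (n : int) : f (x + (2 * pi) *~ n) = f x.
  have fN m y : f (y + (pi *+ 2) *+ m) = f y by exact: periodicn.
  rewrite mulr_natl; case: n => n; first by rewrite -pmulrn fN.
  by rewrite NegzE mulrNz -pmulrn -[in LHS](fN n.+1) subrK.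
set r := t - (2 * pi) *~ k.
have tE : t = r + (2 * pi) *~ k by rewrite subrK.
rewrite tE (kP _ (@cosD2pi R)) in ct; rewrite tE (kP _ (@sinD2pi R)) in st.
have [r0 r1] : 0 <= r /\ r < 2 * pi.
  have := floor_itv (t / (2 * pi)); rewrite -/k => /andP[].
  rewrite ler_pdivlMr// ltr_pdivrMr// => k0 k1.
  rewrite /r -mulrzr subr_ge0 mulrC; split => //.
  by rewrite ltrBlDr [X in _ < X + _](_ : _ = 1 * (2 * pi)) ?mul1r// -{1}[2 * pi]mul1r -mulrDl addrC -intrD1.
exists k; rewrite tE; suff -> : r = 0 by rewrite add0r.
have [rp|rp] := leP r pi.
  by apply: cos_inj; rewrite ?in_itv/= ?lexx ?pi_ge0 ?cos0 ?r0.
have : sin (r - pi) = 0 by have := sinDpi (r - pi); rewrite subrK st => /esym/eqP; rewrite oppr_eq0 => /eqP.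
have : 0 < sin (r - pi) by rewrite sin_gt0_pi// subr_gt0 rp/= ltrBlDr -mulr2n -mulr_natl.
by move=> /[swap] ->; rewrite ltxx.
Qed.

End ComplexArithmetic.

(** * Real and complex differentiation on the plane *)

Section PlaneCalculus.
Context {R : realType}.
Implicit Types (f g : 'rV[R]_2 -> R) (u v : 'rV[R]_2) (h k : R[i]).

(** This is the real part of h (v0 + i v1), so a complex number encodes a real linear form on the
    plane. *)
Definition lin2 h v : R := complex.Re h * v 0 0 - complex.Im h * v 0 1.

(* [h] is the Wirtinger-type derivative f_x - i f_y of the real function [f]. *)
Definition rdiff f u h := is_diff u f (lin2 h).

(** Holomorphy with derivative h, as the Cauchy-Riemann equations: the real part has Wirtinger
    derivative h, the imaginary part has -i h. *)
Definition cdiff (F : 'rV[R]_2 -> R[i]) u h :=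
  rdiff (fun v => complex.Re (F v)) u h /\
  rdiff (fun v => complex.Im (F v)) u (complex.Im h -i* complex.Re h).

Lemma rdiff_eq f g u h k : f =1 g -> h = k -> rdiff f u h -> rdiff g u k.
Proof. by move=> /funext <- <-. Qed.

Lemma rdiff_cst (a : R) u : rdiff (fun=> a) u 0.
Proof.
by apply: is_diff_eq (is_diff_cst a u) _; apply/funext => v; rewrite /lin2 /= !mul0r subr0.
Qed.

Lemma rdiffD f g u h k : rdiff f u h -> rdiff g u k ->
  rdiff (fun v => f v + g v) u (h + k).
Proof.
move=> df dg; apply: is_diff_eq (is_diffD df dg) _; apply/funext => v.
by rewrite /lin2 fctE; case: h k {df dg} => [a b] [c d] /=; ring.
Qed.

Lemma rdiffM f g u h k : rdiff f u h -> rdiff g u k ->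
  rdiff (fun v => f v * g v) u ((f u)%:C * k + (g u)%:C * h).
Proof.
move=> df dg; apply: is_diff_eq (is_diffM df dg) _; apply/funext => v.
rewrite -[LHS]/(f u * lin2 k v + g u * lin2 h v).
by rewrite /lin2; case: h k {df dg} => [a b] [c d] /=; ring.
Qed.

Lemma rdiffZ (a : R) f u h : rdiff f u h -> rdiff (fun v => a * f v) u (a%:C * h).
Proof.
move=> df; apply: rdiff_eq (rdiffM (rdiff_cst a u) df) => //.
by rewrite mulr0 addr0.
Qed.

Lemma rdiffN f u h : rdiff f u h -> rdiff (fun v => - f v) u (- h).
Proof.
move=> df; apply: rdiff_eq (rdiffZ (-1) df) => [v|]; first by rewrite mulN1r.
by case: h {df} => a b; apply: complex_eqP => /=; ring.
Qed.

Lemma rdiffB f g u h k : rdiff f u h -> rdiff g u k ->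
  rdiff (fun v => f v - g v) u (h - k).
Proof. by move=> df dg; apply: rdiffD df (rdiffN dg). Qed.

Lemma rdiff_comp (phi : R -> R) (d : R) f u h : is_derive (f u) (1 : R) phi d ->
  rdiff f u h -> rdiff (fun v => phi (f v)) u (d%:C * h).
Proof.
move=> dphi df.
have dp : differentiable phi (f u) by apply/derivable1_diffP; exact: ex_derive.
have dp' : is_diff (f u) phi ( *:%R^~ d).
  by apply: DiffDef => //; rewrite diff1E// derive1E derive_val.
apply: is_diff_eq (is_diff_comp df dp') _; apply/funext => v.
rewrite -[LHS]/(lin2 h v * d).
by rewrite /lin2 /=; case: h {df} => [b c] /=; ring.
Qed.

Lemma rdiffV f u h : f u != 0 -> rdiff f u h ->
  rdiff (fun v => (f v)^-1) u ((- (f u) ^- 2)%:C * h).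
Proof.
move=> f0 df; apply: (rdiff_comp (phi := fun x => x^-1)) => //.
by have := is_deriveV f0 (is_derive_id (f u) (1 : R)); rewrite /GRing.scale /= mulr1.
Qed.

Lemma rdiff_coord (j : 'I_2) u : rdiff (fun v => v 0 j) u ((j == 0)%:R -i* (j == 1)%:R).
Proof.
apply: DiffDef; first exact: differentiable_coord.
have @f : {linear 'rV[R]_2 -> R}.
  by exists (fun N : 'rV[R]_2 => N 0 j); do 2![eexists]; do ?[constructor];
     rewrite ?mxE// => ? *; rewrite ?mxE//; move=> ?; rewrite !mxE.
rewrite (_ : (fun _ => _) = f) // diff_lin; last exact: coord_continuous.
apply/funext => v; rewrite /lin2 /=.
case: j {f} => -[|[|//]] jlt /=.
  by rewrite (_ : Ordinal jlt = 0) ?mul1r ?oppr0 ?mul0r ?subr0//; exact/val_inj.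
by rewrite (_ : Ordinal jlt = 1) ?mul0r ?mulN1r ?opprK ?add0r//; exact/val_inj.
Qed.

Lemma rdiff_derive f u h v : rdiff f u h -> derivable f u v /\ 'D_v f u = lin2 h v.
Proof.
move=> [df dfE]; split; first exact: diff_derivable.
by rewrite deriveE// dfE.
Qed.

Lemma rdiff_continuous f u h : rdiff f u h -> {for u, continuous f}.
Proof. by move=> [df _]; exact: differentiable_continuous. Qed.

Lemma cdiff_eq F G u h k : F =1 G -> h = k -> cdiff F u h -> cdiff G u k.
Proof. by move=> /funext <- <-. Qed.

Lemma cdiff_cst (a : R[i]) u : cdiff (fun=> a) u 0.
Proof.
split; first exact: rdiff_cst.
by apply: rdiff_eq (rdiff_cst (complex.Im a) u) => //=; rewrite oppr0.
Qed.

Lemma cdiff_cplx u : cdiff (fun v => cplx v) u 1.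
Proof.
split; first by apply: rdiff_eq (rdiff_coord 0 u) => //=; rewrite oppr0.
exact: rdiff_eq (rdiff_coord 1 u).
Qed.

Lemma cdiffD F G u h k : cdiff F u h -> cdiff G u k ->
  cdiff (fun v => F v + G v) u (h + k).
Proof.
move=> [dF1 dF2] [dG1 dG2]; split.
  by apply: rdiff_eq (rdiffD dF1 dG1) => // v; case: (F v) (G v) => [? ?] [].
apply: rdiff_eq (rdiffD dF2 dG2) => [v|]; first by case: (F v) (G v) => [? ?] [].
by case: h k {dF1 dF2 dG1 dG2} => [? ?] [? ?]; apply: complex_eqP => /=; ring.
Qed.

Lemma cdiffM F G u h k : cdiff F u h -> cdiff G u k ->
  cdiff (fun v => F v * G v) u (F u * k + G u * h).
Proof.
move=> [dF1 dF2] [dG1 dG2]; split.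
  apply: rdiff_eq (rdiffB (rdiffM dF1 dG1) (rdiffM dF2 dG2)) => [v|].
    by case: (F v) (G v) => [? ?] [].
  case: h k (F u) (G u) {dF1 dF2 dG1 dG2} => [? ?] [? ?] [? ?] [? ?].
  by apply: complex_eqP => /=; ring.
apply: rdiff_eq (rdiffD (rdiffM dF1 dG2) (rdiffM dF2 dG1)) => [v|].
  by case: (F v) (G v) => [? ?] [? ?] /=; ring.
case: h k (F u) (G u) {dF1 dF2 dG1 dG2} => [? ?] [? ?] [? ?] [? ?].
by apply: complex_eqP => /=; ring.
Qed.

Lemma cdiffZ (a : R[i]) F u h : cdiff F u h -> cdiff (fun v => a * F v) u (a * h).
Proof.
move=> dF; apply: cdiff_eq (cdiffM (cdiff_cst a u) dF) => //.
by rewrite mulr0 addr0.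
Qed.

Lemma cdiffB F G u h k : cdiff F u h -> cdiff G u k ->
  cdiff (fun v => F v - G v) u (h - k).
Proof.
move=> dF dG; apply: cdiff_eq (cdiffD dF (cdiffZ (-1) dG)) => [v|]; by rewrite mulN1r.
Qed.

Lemma rdiff_nsq F u h : cdiff F u h ->
  rdiff (fun v => nsq (F v)) u (2 * (F u)^* * h).
Proof.
move=> [dF1 dF2]; apply: rdiff_eq (rdiffD (rdiffM dF1 dF1) (rdiffM dF2 dF2)) => //.
by case: h (F u) {dF1 dF2} => [? ?] [? ?]; apply: complex_eqP => /=; ring.
Qed.

Lemma complex_invE (z : R[i]) :
  z^-1 = (complex.Re z / nsq z) -i* (complex.Im z / nsq z).
Proof. by case: z => a b; apply: complex_eqP. Qed.

Lemma cdiffV F u h : F u != 0 -> cdiff F u h ->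
  cdiff (fun v => (F v)^-1) u (- ((F u)^-1 * (F u)^-1) * h).
Proof.
move=> F0 dF; have n0 : nsq (F u) != 0 by rewrite gt_eqF// nsq_gt0.
have dn := rdiffV n0 (rdiff_nsq dF).
case: dF => [dF1 dF2]; split.
  apply: rdiff_eq (rdiffM dF1 dn) => [v|]; first by rewrite [in RHS]complex_invE.
  rewrite complex_invE; move: n0; rewrite /nsq.
  case: h (F u) {dF1 dF2 dn F0} => [? ?] [? ?] /= n0.
  by apply: complex_eqP => /=; field.
apply: rdiff_eq (rdiffN (rdiffM dF2 dn)) => [v|]; first by rewrite [in RHS]complex_invE.
rewrite complex_invE; move: n0; rewrite /nsq.
case: h (F u) {dF1 dF2 dn F0} => [? ?] [? ?] /= n0.
by apply: complex_eqP => /=; field.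
Qed.

(** Writing the derivative of F as F h makes h its logarithmic derivative, and ln |F| is locally the
    real part of a logarithm of F. *)
Lemma rdiff_ln_cabs F u h : F u != 0 -> cdiff F u (F u * h) ->
  rdiff (fun v => ln (cabs (F v))) u h.
Proof.
move=> F0 dF; have n0 : 0 < nsq (F u) by rewrite nsq_gt0.
have dn := rdiffZ (2^-1) (rdiff_comp (is_derive1_ln n0) (rdiff_nsq dF)).
apply: rdiff_eq dn => [v|].
  (* [rdiff_eq] asks for equality at every point, zeros of F included; there both sides vanish by
     the default value of [ln] at 0. *)
  rewrite cabsE; have [->|Fv0] := eqVneq (F v) 0.
    by rewrite /nsq /= expr0n/= addr0 sqrtr0 ln0// mulr0.
  have nv : 0 < Num.sqrt (nsq (F v)) by rewrite sqrtr_gt0 nsq_gt0.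
  have := sqr_sqrtr (nsq_ge0 (F v)); move: nv; set s := Num.sqrt _ => s0 <-.
  by rewrite lnXn// -[ln s *+ 2]mulr_natl mulrA mulVf ?mul1r.
move: n0; rewrite /nsq; case: h (F u) {dF F0} => [? ?] [? ?] /= n0.
by apply: complex_eqP => /=; field; rewrite gt_eqF.
Qed.

(* The local branch of the argument of [F]; its derivative is the conjugate
   of that of [ln (cabs F)]. *)
Lemma rdiff_atan F u h : 0 < complex.Re (F u) -> cdiff F u (F u * h) ->
  rdiff (fun v => atan (complex.Im (F v) / complex.Re (F v))) u
        (complex.Im h -i* complex.Re h).
Proof.
move=> F0 [dF1 dF2].
have F0' : complex.Re (F u) != 0 by rewrite gt_eqF.
have F1 : complex.Re (F u) ^+ 2 + complex.Im (F u) ^+ 2 != 0.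
  by rewrite gt_eqF// ltr_pwDl ?sqr_ge0// exprn_gt0.
have dq := rdiffM dF2 (rdiffV F0' dF1).
apply: rdiff_eq (rdiff_comp (is_derive1_atan _) dq) => //.
move: F0' F1; case: h (F u) {dF1 dF2 dq F0} => [? ?] [? ?] /= n0 n1.
by apply: complex_eqP => /=; field; rewrite n0.
Qed.

End PlaneCalculus.

Lemma continuous_coordP (R : realType) (T : topologicalType) n (F : T -> 'rV[R]_n) (u : T) :
  (forall j, {for u, continuous (fun v => F v 0 j)}) -> {for u, continuous F}.
Proof.
move=> cF A [P nP PA].
have : \forall v \near u, forall j, P 0 j (F v 0 j).
  exact: (@filter_forall _ _ (fun j v => P 0 j (F v 0 j)) (nbhs u) _ (fun j => cF j _ (nP 0 j))).
by apply: filterS => v Pv; apply: PA => i j; rewrite ord1.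
Qed.

(** * Weierstrass data: smoothness, conformality, zero mean curvature *)

Section HarmonicImmersions.
Context {R : realType}.
Implicit Types (F : 'rV[R]_2 -> 'rV[R]_3) (U : set 'rV[R]_2) (u v : 'rV[R]_2).

(** Only a chain of complex derivatives is recorded; each differentiability already yields
    continuity. *)
Fixpoint cdiffk (k : nat) U (h : 'rV[R]_2 -> R[i]) : Prop :=
  if k is k'.+1 then
    exists2 h', (forall u, U u -> cdiff h u (h' u)) & cdiffk k' U h'
  else True.

Lemma cdiffkZ k U (a : R[i]) h : cdiffk k U h -> cdiffk k U (fun u => a * h u).
Proof.
elim: k h => //= k IH h [h' dh kh']; exists (fun u => a * h' u); last exact: IH.
by move=> u Uu; apply: cdiffZ; exact: dh.
Qed.

Lemma cdiffkD k U g h : cdiffk k U g -> cdiffk k U h ->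
  cdiffk k U (fun u => g u + h u).
Proof.
elim: k g h => //= k IH g h [g' dg kg'] [h' dh kh'].
exists (fun u => g' u + h' u); last exact: IH.
by move=> u Uu; apply: cdiffD; [exact: dg|exact: dh].
Qed.

Lemma cdiffkM k U g h : cdiffk k U g -> cdiffk k U h ->
  cdiffk k U (fun u => g u * h u).
Proof.
(* The product rule reuses the undifferentiated factors one level lower. *)
have pred1 m f : cdiffk m.+1 U f -> cdiffk m U f.
  by elim: m f => //= m IH f [f' df kf']; exists f' => //; exact: IH.
elim: k g h => //= k IH g h /[dup] /pred1 kg [g' dg kg'] /[dup] /pred1 kh [h' dh kh'].
exists (fun u => g u * h' u + h u * g' u); last by apply: cdiffkD; exact: IH.
by move=> u Uu; apply: cdiffM; [exact: dg|exact: dh].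
Qed.

(** The derivative of a simple pole is minus its square, hence again a product of poles, which
    closes the induction. *)
Lemma cdiffk_pole k U (z : R[i]) : (forall u, U u -> cplx u != z) ->
  cdiffk k U (fun u => (cplx u - z)^-1).
Proof.
move=> Uz; elim: k => //= k IH.
exists (fun u => - 1 * ((cplx u - z)^-1 * (cplx u - z)^-1)).
  move=> u /Uz uz; have {}uz : cplx u - z != 0 by rewrite subr_eq0.
  apply: cdiff_eq (cdiffV uz (cdiffB (cdiff_cplx u) (cdiff_cst z u))) => //.
  by rewrite subr0 mulr1 mulN1r.
by apply: cdiffkZ; exact: cdiffkM.
Qed.

(** Needed because the explicit formula for a partial derivative is known on U only; openness lets
    the equality pass to derivatives. *)
Lemma Ck_eq k U F G : open U -> (forall u, U u -> F u = G u) -> Ck k U F -> Ck k U G.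
Proof.
move=> oU; elim: k F G => [|k IH] F G FG /=.
all: have near_FG u : U u -> \forall v \near u, F v = G v.
1,3: by move=> Uu; exact: (filterS FG (open_nbhs_nbhs (conj oU Uu))).
all: have cFG : (forall u, U u -> {for u, continuous F}) -> forall u, U u -> {for u, continuous G}.
1,3: move=> cF u Uu; rewrite /prop_for /continuous_at -(FG u Uu).
1,2: exact: cvg_trans (@near_eq_cvg _ _ (nbhs u) _ _ _ (near_FG u Uu)) (cF u Uu).
  by move=> [/cFG].
move=> [/cFG cF dF]; split=> // i; have [dF1 dF2] := dF i; split.
  by move=> u Uu; apply: near_eq_derivable (dF1 u Uu); exact: near_FG.
by apply: IH dF2 => u Uu; apply: near_eq_derive; exact: near_FG.
Qed.

(* The data of a Weierstrass representation: F_x - i F_y = H coordinatewise. *)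
Definition weierstrass U F (H : 'I_3 -> 'rV[R]_2 -> R[i]) :=
  forall j u, U u -> rdiff (fun v => F v 0 j) u (H j u).

Lemma weierstrass_partial U F H u (i : 'I_2) : weierstrass U F H -> U u ->
  derivable F u (delta_mx 0 i) /\
  partial i F u = \row_j (if i == 0 then complex.Re (H j u) else - complex.Im (H j u)).
Proof.
move=> wF Uu; have dF : derivable F u (delta_mx 0 i).
  by apply/derivable_mxP => k j; rewrite ord1; case: (rdiff_derive (delta_mx 0 i) (wF j u Uu)).
split=> //; rewrite /partial derive_mx//; apply/matrixP => k j; rewrite !mxE ord1.
rewrite (rdiff_derive _ (wF j u Uu)).2 /lin2 !mxE !eqxx/=.
case: i {dF} => -[|[|//]] ? /=; rewrite ?mulr1 ?mulr0 ?subr0 ?sub0r//.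
Qed.

(** A partial derivative of F has Weierstrass data of its own: F_x = Re H with data H', and F_y = -
    Im H with data i H'. The induction on the order therefore generalises over F and H. *)
Lemma smooth_weierstrass U F H : open U -> weierstrass U F H ->
  (forall j k, cdiffk k U (H j)) -> smooth U F.
Proof.
move=> oU wF kH k.
have {}kH : forall j, cdiffk k U (H j) by move=> j; exact: kH.
elim: k F H wF kH => [|k IH] F H wF kH.
  by split=> // u Uu; apply: continuous_coordP => j; exact: rdiff_continuous (wF j u Uu).
split.
  by move=> u Uu; apply: continuous_coordP => j; exact: rdiff_continuous (wF j u Uu).
have /choice[H' HH'] : forall j, exists h', (forall u, U u -> cdiff (H j) u (h' u)) /\ cdiffk k U h'.
  by move=> j; have [h' ? ?] := kH j; exists h'.
move=> i; split.
  by move=> u Uu; have [] := weierstrass_partial i wF Uu.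
pose G u := \row_(j < 3) (if i == 0 then complex.Re (H j u) else - complex.Im (H j u)).
apply: (@Ck_eq k U G) => //.
  by move=> u Uu; have [_ ->] := weierstrass_partial i wF Uu.
pose a : R[i] := if i == 0 then 1 else 'i%C.
apply: (IH G (fun j u => a * H' j u)); last first.
  by move=> j; apply: cdiffkZ; have [] := HH' j.
move=> j u Uu; have [dH1 dH2] := (HH' j).1 u Uu; rewrite /a /G.
case: (i == 0).
  by apply: rdiff_eq dH1 => [v|]; rewrite ?mxE ?mul1r.
apply: rdiff_eq (rdiffN dH2) => [v|]; rewrite ?mxE//.
by case: (H' j u) => ? ?; apply: complex_eqP => /=; ring.
Qed.

Lemma sum3 (T : zmodType) (f : 'I_3 -> T) : \sum_j f j = f 0 + f 1 + f 2.
Proof.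
rewrite !big_ord_recl big_ord0 addr0 addrA; congr (f _ + f _ + f _); exact/val_inj.
Qed.

Section Conformal.
Context (U : set 'rV[R]_2) (F : 'rV[R]_2 -> 'rV[R]_3) (H : 'I_3 -> 'rV[R]_2 -> R[i])
  (wF : weierstrass U F H) (nullH : forall u, U u -> \sum_j H j u ^+ 2 = 0).

(** With H = F_x - i F_y, the real part of the sum of squares is |F_x|^2 - |F_y|^2 and its imaginary
    part is -2 F_x . F_y. *)
Lemma conformal u : U u ->
  dot (partial 0 F u) (partial 0 F u) = dot (partial 1 F u) (partial 1 F u) /\
  dot (partial 0 F u) (partial 1 F u) = 0.
Proof.
move=> Uu; have := nullH Uu; rewrite !sum3.
rewrite !(weierstrass_partial _ wF Uu).2 /dot !sum3 !mxE /=.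
case: (H 0 u) (H 1 u) (H 2 u) => [? ?] [? ?] [? ?] [/= e1 e2].
split; first by apply/eqP; rewrite -subr_eq0 -e1; apply/eqP; ring.
by apply: (@mulfI _ (-2)); rewrite ?oppr_eq0// mulr0 -[RHS]e2; ring.
Qed.

(** The two partial derivatives are orthogonal of equal length, and a nonzero H j makes that length
    nonzero. *)
Lemma immersed_weierstrass : (forall u, U u -> exists j, H j u != 0) -> immersed U F.
Proof.
move=> H0 u Uu; have [E F0] := conformal Uu.
have sq0 (p : 'rV[R]_3) : dot p p = 0 -> forall k, p 0 k = 0.
  move/eqP; rewrite /dot psumr_eq0 => [|? _]; last by rewrite -expr2 sqr_ge0.
  by move=> /allP p0 k; have := p0 k (mem_index_enum k); rewrite mulf_eq0 orbb => /eqP.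
have Epos : dot (partial 0 F u) (partial 0 F u) != 0.
  have [j Hj] := H0 u Uu; apply/eqP => E0.
  have := sq0 _ E0 j; rewrite E in E0; have := sq0 _ E0 j.
  rewrite !(weierstrass_partial _ wF Uu).2 !mxE /=.
  by move: Hj; case: (H j u) => a b /= /eqP Hj /eqP; rewrite oppr_eq0 => /eqP b0 a0; apply: Hj; rewrite a0 b0.
set M := \matrix_(i < 2) _; apply: inj_row_free => v vM.
have row0 : v 0 0 *: partial 0 F u + v 0 1 *: partial 1 F u = 0.
  by rewrite -vM mulmx_sum_row big_ord_recl big_ord1 !rowK; congr (_ *: _ + v 0 _ *: partial _ _ _); exact/val_inj.
have dotl (p q r : 'rV[R]_3) (a b : R) : dot (a *: p + b *: q) r = a * dot p r + b * dot q r.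
  by rewrite /dot !sum3 !mxE; ring.
have dot0 (r : 'rV[R]_3) : dot 0 r = 0 by rewrite /dot !sum3 !mxE; ring.
have dotC (p q : 'rV[R]_3) : dot p q = dot q p by rewrite /dot !sum3; ring.
have orth (p q : 'rV[R]_3) (a b : R) : dot p p = dot q q -> dot p q = 0 ->
    dot p p != 0 -> a *: p + b *: q = 0 -> a = 0 /\ b = 0.
  move=> pq pq0 p0 apbq.
  have := dotl p q q a b; rewrite apbq dot0 pq0 -pq mulr0 add0r.
  move=> /esym/eqP; rewrite mulf_eq0 (negPf p0) orbF => /eqP b0.
  have := dotl p q p a b; rewrite apbq dot0 b0 mul0r addr0.
  by move=> /esym/eqP; rewrite mulf_eq0 (negPf p0) orbF => /eqP a0; split.
have [v0 v1] := orth _ _ _ _ E F0 Epos row0.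
apply/rowP => -[[|[|//]] ilt]; rewrite mxE.
  by rewrite -[RHS]v0; congr (v 0 _); exact/val_inj.
by rewrite -[RHS]v1; congr (v 0 _); exact/val_inj.
Qed.

(* The coordinates of [F] are harmonic, so in conformal coordinates e + g and
   f (F) vanish together. *)
Lemma mean_curvature_weierstrass : open U -> (forall j, cdiffk 1 U (H j)) ->
  forall u, U u -> mean_curvature F u = 0.
Proof.
move=> oU kH u Uu.
have /choice[H' HH'] : forall j, exists h', forall u, U u -> cdiff (H j) u (h' u).
  by move=> j; have [h' ? ?] := kH j; exists h'.
have second i : partial i (partial i F) u = \row_j ((-1) ^+ (i == 1) * complex.Re (H' j u)).
  pose G u := \row_(j < 3) (if i == 0 then complex.Re (H j u) else - complex.Im (H j u)).
  have -> : partial i (partial i F) u = partial i G u.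
    apply: near_eq_derive; apply: filterS (open_nbhs_nbhs (conj oU Uu)) => v Uv.
    exact: (weierstrass_partial _ wF Uv).2.
  have wG : weierstrass U G (fun j u => (if i == 0 then 1 else 'i%C) * H' j u).
    move=> j v Uv; have [dH1 dH2] := HH' j v Uv; rewrite /G; case: (i == 0).
      by apply: rdiff_eq dH1 => [w|]; rewrite ?mxE ?mul1r.
    apply: rdiff_eq (rdiffN dH2) => [w|]; rewrite ?mxE//.
    by case: (H' j v) => ? ?; apply: complex_eqP => /=; ring.
  rewrite (weierstrass_partial _ wG Uu).2; apply/rowP => j; rewrite !mxE.
  by case: i {G wG} => -[|[|//]] ? /=; case: (H' j u) => ? ? /=; rewrite ?expr0 ?expr1; ring.
have [E F0] := conformal Uu.
have opp : partial 1 (partial 1 F) u = - partial 0 (partial 0 F) u.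
  by rewrite !second; apply/rowP => j; rewrite !mxE /= expr0 expr1 mulN1r mul1r.
have dotNl (p q : 'rV[R]_3) : dot (- p) q = - dot p q.
  by rewrite /dot !sum3 !mxE; ring.
have alg (fu fv fuu fuv fvv n : 'rV[R]_3) : dot fu fu = dot fv fv -> dot fu fv = 0 ->
    fvv = - fuu -> (dot fuu n * dot fv fv - 2 * dot fuv n * dot fu fv + dot fvv n * dot fu fu)
    / (2 * (dot fu fu * dot fv fv - dot fu fv ^+ 2)) = 0.
  by move=> -> -> ->; rewrite dotNl; ring.
exact: alg E F0 opp.
Qed.

End Conformal.
End HarmonicImmersions.

(** * Topology of the plane and of the two charts of the sphere *)

Section PlaneTopology.
Context {R : realType}.
Implicit Types (z w : Cplane R) (u v : 'rV[R]_2).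

Definition uncplx z : 'rV[R]_2 := \row_(j < 2) [:: complex.Re z; complex.Im z]`_j.

Lemma uncplxK : cancel uncplx cplx.
Proof. by move=> [a b]; rewrite /cplx !mxE. Qed.

Lemma cplxK : cancel cplx uncplx.
Proof.
by move=> u; apply/rowP => -[[|[|//]] ilt]; rewrite mxE /=; congr (u 0 _); exact/val_inj.
Qed.

Lemma Re_le_cabs z : `|complex.Re z| <= cabs z.
Proof. by rewrite cabsE -sqrtr_sqr ler_wsqrtr// lerDl sqr_ge0. Qed.

Lemma Im_le_cabs z : `|complex.Im z| <= cabs z.
Proof. by rewrite cabsE -sqrtr_sqr ler_wsqrtr// lerDr sqr_ge0. Qed.

Lemma cabs_le z : cabs z <= `|complex.Re z| + `|complex.Im z|.
Proof.
rewrite -(@ler_pXn2r _ 2)// ?nnegrE ?cabs_ge0 ?addr_ge0//.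
rewrite cabs_sqr /nsq -(real_normK (num_real (complex.Re z))) -(real_normK (num_real (complex.Im z))).
by rewrite sqrrD addrAC lerDl mulrn_wge0// mulr_ge0.
Qed.

Lemma cabsBC z w : cabs (z - w) = cabs (w - z).
Proof. by rewrite /cabs -normrN opprB. Qed.

Lemma nbhs_cabs z (P : set (Cplane R)) :
  nbhs z P <-> exists2 e : R, 0 < e & forall w, cabs (w - z) < e -> P w.
Proof.
split=> [/nbhs_normP[/= e e0 zP]|[e e0 zP]].
  (* The norm of [R[i]] is itself complex-valued, so the radius is a complex number; being positive
     forces it to be real. *)
  move: e0; rewrite ltcE /= => /andP[/eqP e1 e0].
  exists (complex.Re e) => // w wz; apply: zP => /=.
  by rewrite -opprB normrN norm_cabs ltcE /= wz e1 eqxx.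
rewrite -nbhs_nbhs_norm; exists e%:C => /=; first by rewrite ltcR.
by move=> w /=; rewrite -opprB normrN norm_cabs ltcR; exact: zP.
Qed.

Lemma norm_coord_le (v : 'rV[R]_2) j : `|v 0 j| <= `|v|.
Proof.
rewrite [leRHS]/Num.norm /= mx_normrE; apply/bigmax_geP; right.
by exists (0, j).
Qed.

Lemma cplx_continuous : continuous (cplx : 'rV[R]_2 -> Cplane R).
Proof.
move=> u P /nbhs_cabs[e e0 uP].
suff : nbhs u (cplx @^-1` P) by [].
rewrite -nbhs_nbhs_norm; exists (e / 2) => /=; first by rewrite divr_gt0.
move=> v /= uv; apply: uP; apply: le_lt_trans (cabs_le _) _.
have {}uv j : `|v 0 j - u 0 j| < e / 2.
  rewrite -opprB normrN; apply: le_lt_trans uv.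
  by have := norm_coord_le (u - v) j; rewrite !mxE.
rewrite /= [e]splitr; exact: ltrD (uv 0) (uv 1).
Qed.

Lemma ReB_le_cabs (z w : R[i]) : `|complex.Re z - complex.Re w| <= cabs (z - w).
Proof. by case: z w => [a b] [c d]; exact: (Re_le_cabs ((a +i* b) - (c +i* d))). Qed.

Lemma ImB_le_cabs (z w : R[i]) : `|complex.Im z - complex.Im w| <= cabs (z - w).
Proof. by case: z w => [a b] [c d]; exact: (Im_le_cabs ((a +i* b) - (c +i* d))). Qed.

Lemma uncplx_continuous : continuous uncplx.
Proof.
move=> z P /nbhs_normP[/= e e0 zP]; apply/nbhs_cabs; exists e => // w wz; apply: zP => /=.
rewrite /Num.norm /= mx_normrE; apply/bigmax_ltP; split=> // -[i j] _ /=.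
rewrite !mxE; rewrite cabsBC in wz; apply: le_lt_trans wz.
by case: j => -[|[|//]] ? /=; [exact: ReB_le_cabs|exact: ImB_le_cabs].
Qed.

Lemma Re_continuous : continuous (fun z => complex.Re z : R).
Proof.
move=> z P /nbhs_normP[/= e e0 zP]; apply/nbhs_cabs; exists e => // w wz; apply: zP => /=.
by rewrite cabsBC in wz; apply: le_lt_trans wz; exact: ReB_le_cabs.
Qed.

Lemma Im_continuous : continuous (fun z => complex.Im z : R).
Proof.
move=> z P /nbhs_normP[/= e e0 zP]; apply/nbhs_cabs; exists e => // w wz; apply: zP => /=.
by rewrite cabsBC in wz; apply: le_lt_trans wz; exact: ImB_le_cabs.
Qed.

Lemma nsq_continuous : continuous (fun z => nsq z : R).
Proof.
rewrite (_ : (fun z => nsq z : R) = fun z => complex.Re z * complex.Re z + complex.Im z * complex.Im z)//.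
move=> z.
have h1 : {for z, continuous (fun z : Cplane R => complex.Re z * complex.Re z : R)}.
 by apply: (@continuousM R (Cplane R)); exact: Re_continuous.
have h2 : {for z, continuous (fun z : Cplane R => complex.Im z * complex.Im z : R)}.
 by apply: (@continuousM R (Cplane R)); exact: Im_continuous.
exact: (@continuousD R R (Cplane R) _ _ z h1 h2).
Qed.

Lemma nbhs_neq z (a : R[i]) : z != a -> nbhs z [set w : Cplane R | w != a].
Proof.
move=> za; apply/nbhs_cabs; exists (cabs (a - z)).
  by rewrite cabs_gt0 subr_eq0 eq_sym.
by move=> w; apply: contraPN => /eqP ->; rewrite ltxx.
Qed.

Lemma cabs_continuous : continuous (fun z => cabs z : R).
Proof.
rewrite (_ : (fun z => cabs z : R) = Num.sqrt \o (fun z => nsq z)); last first.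
  by apply/funext => z; rewrite cabsE.
by move=> z; apply: continuous_comp; [exact: nsq_continuous|exact: sqrt_continuous].
Qed.

Lemma chart0_open (V : set 'rV[R]_2) : open V -> open (chart0 @` V).
Proof.
move=> oV; rewrite (_ : chart0 @` V = Some @` (uncplx @^-1` V)).
  apply: one_point_compactification_open_some; apply: open_comp oV => z _.
  exact: uncplx_continuous.
apply/seteqP; split=> [_ [u Vu <-]|_ [z Vz <-]].
  by exists (cplx u) => //=; rewrite cplxK.
by exists (uncplx z) => //; rewrite /chart0 uncplxK.
Qed.

Lemma chart0_inj : injective (chart0 : 'rV[R]_2 -> rsphere R).
Proof. by move=> u v [uv0 uv1]; rewrite -(cplxK u) -(cplxK v) /cplx uv0 uv1. Qed.

Lemma chart_infty_inj : injective (chart_infty : 'rV[R]_2 -> rsphere R).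
Proof.
move=> u v; rewrite /chart_infty => e; apply: (can_inj cplxK); move: e.
have [u0|u0] := eqVneq (cplx u) 0; have [v0|v0] := eqVneq (cplx v) 0 => //.
  by rewrite u0 v0.
by move=> [e0 e1]; apply: (@invr_inj R[i]); apply: complex_eqP.
Qed.

Lemma closed_disc_compact (r : R) : compact [set z : Cplane R | cabs z <= r].
Proof.
rewrite (_ : [set z | _] = cplx @` [set u : 'rV[R]_2 | cabs (cplx u) <= r]); last first.
  apply/seteqP; split=> [z zr|_ [u ur <-]//].
  by exists (uncplx z); rewrite /= uncplxK.
apply: continuous_compact; first by apply: continuous_subspaceT; exact: cplx_continuous.
apply: bounded_closed_compact.
  exists `|r|; split=> // M rM u /= ur; apply: ltW.
  rewrite /Num.norm /= mx_normrE; apply/bigmax_ltP; split; first by apply: le_lt_trans rM.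
  move=> [i j] _ /=; apply: le_lt_trans (lt_le_trans _ (lexx M)); last first.
    by apply: le_lt_trans rM; apply: le_trans ur _; exact: ler_norm.
  rewrite ord1; case: j => -[|[|//]] jlt.
    by rewrite (_ : Ordinal jlt = 0); [exact: Re_le_cabs (cplx u)|exact/val_inj].
  by rewrite (_ : Ordinal jlt = 1); [exact: Im_le_cabs (cplx u)|exact/val_inj].
rewrite (_ : mkset _ = (cabs \o cplx) @^-1` [set x : R | x <= r])//.
apply: preimage_closed => [u _|]; last exact: closed_le.
by apply: continuous_comp; [exact: cplx_continuous|exact: cabs_continuous].
Qed.

(** Closed discs are closed and compact, so removing one leaves a neighbourhood of the added
    point. *)
Lemma nbhs_infty (P : set (rsphere R)) (r : R) : P None ->
  (forall z, r < cabs z -> P (Some z)) -> nbhs (None : rsphere R) P.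
Proof.
move=> P0 Pr; exists [set z : Cplane R | cabs z <= r].
  split; first exact: closed_disc_compact.
  apply: compact_closed; [exact: norm_hausdorff|exact: closed_disc_compact].
by move=> _ [[z /= zr <-]|->//]; apply: Pr; rewrite ltNge; apply/negP.
Qed.

(** At u = 0 a disc of radius e in the chart covers all |z| > 1/e; elsewhere continuity of inversion
    suffices. *)
Lemma chart_infty_open (V : set 'rV[R]_2) : open V -> open (chart_infty @` V).
Proof.
move=> oV; rewrite openE => _ [u Vu <-].
have {}Vu := open_nbhs_nbhs (conj oV Vu).
rewrite /interior /chart_infty; case: eqP => [u0|/eqP u0].
  have : nbhs (0 : Cplane R) (uncplx @^-1` V).
    by apply: uncplx_continuous; rewrite -[0 : Cplane R]u0 cplxK.
  move=> /nbhs_cabs[e e0 eV].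
  apply: (@nbhs_infty _ e^-1).
    by exists u; [exact: nbhs_singleton|rewrite u0 eqxx].
  move=> z ez; have z0 : 0 < cabs z by apply: lt_trans ez; rewrite invr_gt0.
  exists (uncplx z^-1); first by apply: eV; rewrite subr0 cabsV invf_plt.
  rewrite uncplxK (_ : z^-1 == 0 = false) ?invrK//.
  by apply/negP => /eqP zV0; move: z0; rewrite -[z]invrK zV0 invr0 cabs_gt0 eqxx.
have uV0 : ((cplx u)^-1 : Cplane R) != 0 by rewrite invr_eq0.
have : nbhs ((cplx u)^-1 : Cplane R) (GRing.inv @^-1` (uncplx @^-1` V)).
  apply: (inv_continuous (x := (cplx u)^-1 : R[i])) => //.
  by rewrite invrK; apply: uncplx_continuous; rewrite cplxK.
have := nbhs_neq uV0.
move=> n1 n2; apply: (filterS _ (filterI n1 n2)) => z /= [z0 zV].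
by exists (uncplx z^-1) => //; rewrite uncplxK invr_eq0 (negPf z0) invrK.
Qed.

End PlaneTopology.

(** * Coordinates on the quotient and its Hausdorff property *)

Section QuotientTopology.
Context {R : realType}.
Implicit Types (p : 'rV[R]_3) (q : quot3 R).

(** Trading the integer shift for an equation between unit complex numbers turns every comparison of
    heights into algebra. *)
Lemma qprojP p p' : qproj p = qproj p' <->
  [/\ cx p = cx p', cy p = cy p' & expi (cz p) = expi (cz p')].
Proof.
have orbP : qproj p = qproj p' <-> orbit_rel p p'.
  by split=> e; exact/(eqmodP (@orbit_equiv_rel R) p p').
have shiftE (k : int) j : (vec3 0 0 (2 * pi : R) *~ k) 0 j = [:: 0; 0; (2 * pi) *~ k]`_j.
  rewrite -scaler_int !mxE -[in RHS]mulrzl.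
  by case: j => -[|[|[|//]]] ? /=; rewrite ?mulr0.
split=> [/orbP/asboolP[k ->]|[ex ey /expi_eq[k ez]]].
  rewrite /cx /cy /cz !mxE !shiftE/= !addr0; split=> //.
  rewrite expiD (_ : expi (_ *~ k) = 1) ?mulr1//.
  have e2 : expi (2 * pi) = 1 :> R[i] by rewrite mulr_natl /expi cos2pi sin2pi.
  case: k => n; first rewrite -pmulrn.
    by elim: n => [|n IH]; rewrite ?mulr0n ?expi0// mulrS expiD e2 IH mulr1.
  rewrite NegzE mulrNz -pmulrn expiN (_ : expi _ = 1) ?invr1//.
  by elim: n.+1 => [|m IH]; rewrite ?mulr0n ?expi0// mulrS expiD e2 IH mulr1.
apply/orbP/asboolP; exists k; apply/rowP => j; rewrite mxE shiftE.
case: j => -[|[|[|//]]] jlt /=; rewrite ?addr0.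
- by rewrite (_ : Ordinal jlt = 0)//; exact/val_inj.
- by rewrite (_ : Ordinal jlt = 1)//; exact/val_inj.
by rewrite (_ : Ordinal jlt = 2%:R)//; exact/val_inj.
Qed.

(** [qx], [qy] and [qz] read a chosen representative; [qxE], [qyE] and [qzE] show that the choice
    does not matter. *)
Definition qx q : R := cx (repr q).
Definition qy q : R := cy (repr q).
Definition qz q : Cplane R := expi (cz (repr q)).

Lemma qprojK q : qproj (repr q) = q.
Proof. exact: reprK. Qed.

Lemma qxE p : qx (qproj p) = cx p.
Proof. by have /qprojP[] := qprojK (qproj p). Qed.

Lemma qyE p : qy (qproj p) = cy p.
Proof. by have /qprojP[] := qprojK (qproj p). Qed.

Lemma qzE p : qz (qproj p) = expi (cz p).
Proof. by have /qprojP[] := qprojK (qproj p). Qed.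

Lemma qP q q' : qx q = qx q' -> qy q = qy q' -> qz q = qz q' -> q = q'.
Proof. by move=> ex ey ez; rewrite -(qprojK q) -(qprojK q'); apply/qprojP. Qed.

Lemma qproj_continuous : continuous (qproj : 'rV[R]_3 -> quot3 R).
Proof. exact: pi_continuous. Qed.

Lemma qx_continuous : continuous qx.
Proof.
apply/quotient_continuous; rewrite (_ : _ \o _ = cx); last by apply/funext => p; exact: qxE.
exact: coord_continuous.
Qed.

Lemma qy_continuous : continuous qy.
Proof.
apply/quotient_continuous; rewrite (_ : _ \o _ = cy); last by apply/funext => p; exact: qyE.
exact: coord_continuous.
Qed.

Lemma expi_continuous : continuous (expi : R -> Cplane R).
Proof.
move=> t; rewrite (_ : (expi : R -> Cplane R) = cplx \o (fun t => \row_(j < 2) [:: cos t; sin t]`_j)); last first.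
  by apply/funext => s; rewrite /= /cplx !mxE.
apply: continuous_comp; last exact: cplx_continuous.
apply: continuous_coordP => -[[|[|//]] ?] /=.
  rewrite (_ : (fun _ => _) = cos); first exact: continuous_cos.
  by apply/funext => x; rewrite mxE.
rewrite (_ : (fun _ => _) = sin); first exact: continuous_sin.
by apply/funext => x; rewrite mxE.
Qed.

Lemma qz_continuous : continuous qz.
Proof.
apply/quotient_continuous; rewrite (_ : _ \o _ = expi \o cz); last by apply/funext => p; exact: qzE.
by move=> p; apply: continuous_comp; [exact: coord_continuous|exact: expi_continuous].
Qed.

(** The three quotient coordinates are continuous into Hausdorff spaces and together separate
    points. *)
Lemma quot3_hausdorff : hausdorff_space (quot3 R).
Proof.
move=> q q' qq'.
have sep (T : topologicalType) (f : quot3 R -> T) : hausdorff_space T -> continuous f -> f q = f q'.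
  move=> hT cf; apply: hT => A B fA fB.
  have [r [rA rB]] := qq' _ _ (cf q A fA) (cf q' B fB).
  by exists (f r).
apply: qP; apply: sep; (try exact: norm_hausdorff);
  by [exact: qx_continuous|exact: qy_continuous|exact: qz_continuous].
Qed.

End QuotientTopology.

(** * Proper injective maps are embeddings *)

Section ProperEmbedding.
Context {R : realType} {S T : topologicalType} (D : set S) (h : S -> T) (rho : T -> R)
  (cS : compact [set: S]) (crho : continuous rho)
  (hcont : forall w, D w -> {for w, continuous h})
  (hproper : forall w N, ~ D w -> \forall v \near w, D v -> N < rho (h v)).

(** The set is closed in the compact space S: near a point outside D the values of rho exceed N, and
    inside D continuity applies. *)
Lemma proper_sublevel_compact N : compact [set w | D w /\ rho (h w) <= N].
Proof.
apply: subclosed_compact cS _ => //.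
rewrite -openC openE => w nEw.
have [Dw|Dw] := pselect (D w); last first.
  by apply: filterS (hproper N Dw) => v Nv [Dv]; rewrite leNgt Nv.
have Nw : N < rho (h w) by rewrite ltNge; apply/negP => Nw; apply: nEw.
have crh : {for w, continuous (rho \o h)}.
  by apply: continuous_comp; [exact: hcont|exact: crho].
have /crh : nbhs (rho (h w)) [set x | N < x] by apply: open_nbhs_nbhs; split=> //; exact: open_gt.
by move=> nw; apply: (filterS _ (nw : nbhs w _)) => v Nv [_]; rewrite leNgt Nv.
Qed.

Lemma proper_top_embedding : hausdorff_space T -> {in D &, injective h} -> top_embedding D h.
Proof.
move=> hT hinj; split=> //.
  by apply: continuous_in_subspaceT => w /set_mem; exact: hcont.
(* Injectivity makes this complement cut out exactly the image of V, so only closedness of h(D \ V)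
   remains. *)
move=> V oV; exists (~` (h @` (D `\` V))); split; last first.
  apply/seteqP; split=> [_ [w [Dw Vw] <-]|t [nt [w Dw wt]]].
    split; last by exists w.
    by move=> [v [Dv Vv] vw]; apply: Vv; rewrite (hinj v w) ?inE.
  by exists w => //; split=> //; apply: contrapT => Vw; apply: nt; exists w.
apply: closed_openC => t ct; set N := rho t + 1.
pose E := [set w | D w /\ rho (h w) <= N] `&` ~` V.
have cE : compact E by apply: compact_closedI; [exact: proper_sublevel_compact|exact: open_closedC].
have chE : closed (h @` E).
  apply: compact_closed => //; apply: continuous_compact => //.
  by apply: continuous_in_subspaceT => w /set_mem[[Dw _] _]; exact: hcont.
have : closure (h @` E) t.
  move=> B Bt.
  have Nt : nbhs t [set s | rho s < N].
    have : nbhs (rho t) [set x | x < N].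
      by apply: open_nbhs_nbhs; split; [exact: open_lt|rewrite /= /N ltrDl].
    by move=> /crho.
  have [_ [[c [Dc Vc] <-] [Bc /= Nc]]] := ct _ (filterI Bt Nt).
  by exists (h c); split=> //; exists c => //; split=> //; split=> //; exact: ltW.
by move=> /chE[w [[Dw _] Vw] <-]; exists w.
Qed.

End ProperEmbedding.

(** A local lift inherits embeddedness from the global map through an open injective chart, and its
    image is relatively open in the surface. *)
Lemma chart_embedding (R : realType) (S : topologicalType) (D : set S)
    (G : S -> quot3 R) (e : 'rV[R]_2 -> S) (V : set 'rV[R]_2) (f : 'rV[R]_2 -> 'rV[R]_3) :
  top_embedding D G -> injective e -> (forall V', open V' -> open (e @` V')) ->
  open V -> e @` V `<=` D -> (forall v, V v -> G (e v) = qproj (f v)) ->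
  (forall v, V v -> {for v, continuous f}) ->
  top_embedding V (qproj \o f) /\
  exists W : set (quot3 R), open W /\ (qproj \o f) @` V = W `&` G @` D.
Proof.
move=> [Ginj _ Gopen] einj eopen oV VD Gf cf.
have img V' : V' `<=` V -> (qproj \o f) @` V' = G @` (D `&` e @` V').
  move=> V'V; apply/seteqP; split=> [_ [v V'v <-]|_ [_ [_ [v V'v <-]] <-]].
    exists (e v); last exact/Gf/V'V.
    by split; [apply: VD; exists v => //; exact: V'V|exists v].
  by exists v => //; rewrite /= Gf//; exact: V'V.
split; last by have [W WE] := Gopen _ (eopen _ oV); exists W; rewrite img.
split.
- move=> u v /set_mem Vu /set_mem Vv /= /esym uv; apply/esym/einj/Ginj.
  + by apply/mem_set/VD; exists v.
  + by apply/mem_set/VD; exists u.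
  by rewrite !Gf.
- apply: continuous_in_subspaceT => v /set_mem Vv.
  by apply: continuous_comp; [exact: cf|exact: qproj_continuous].
move=> V' oV'; have oVV' := openI oV oV'.
have [W [oW WE]] := Gopen _ (eopen _ oVV').
exists W; split=> //; rewrite img; last exact: subIsetl.
rewrite WE img//; apply/seteqP; split=> [t [Wt Gt]|t [Wt [x [Dx _] xt]]].
  split=> //; have : (G @` (D `&` e @` (V `&` V'))) t by rewrite WE.
  by move=> [x [Dx [v [Vv _] vx]] xt]; exists x => //; split=> //; exists v.
by split=> //; exists x.
Qed.

(** * Unit directions and logarithmic derivatives *)

Section Direction.
Context {R : realType}.
Implicit Types z w : R[i].

(** A multiplicative form of the argument; as [dir 0 = 0], its rules for products and inverses hold
    without side conditions. *)
Definition dir z : R[i] := z / (cabs z)%:C.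

Lemma dirM z w : dir (z * w) = dir z * dir w.
Proof. by rewrite /dir cabsM rmorphM invfM mulrACA. Qed.

Lemma dirV z : dir z^-1 = (dir z)^-1.
Proof. by rewrite /dir cabsV fmorphV invfM. Qed.

Lemma dir_neq0 z : z != 0 -> dir z != 0.
Proof. by move=> z0; rewrite mulf_neq0// invr_eq0 fmorph_eq0 gt_eqF// cabs_gt0. Qed.

Lemma conjcM z w : (z * w)^*%C = z^*%C * w^*%C.
Proof. by case: z w => [a b] [c d]; apply: complex_eqP => /=; ring. Qed.

Lemma conjcD z w : (z + w)^*%C = z^*%C + w^*%C.
Proof. by case: z w => [a b] [c d]; apply: complex_eqP => /=; ring. Qed.

Lemma conjcN z : (- z)^*%C = - z^*%C.
Proof. by case: z => [a b]. Qed.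

Lemma dirN z : dir (- z) = - dir z.
Proof. by rewrite /dir /cabs normrN mulNr. Qed.

Lemma dir_conj z : dir z^*%C = (dir z)^*%C.
Proof.
rewrite /dir conjcM conjc_inv conjc_real.
by rewrite [cabs _^*%C]cabsE [cabs z]cabsE /nsq; case: z => a b /=; rewrite sqrrN.
Qed.

Lemma dir_expi (t : R) : dir (expi t) = expi t.
Proof. by rewrite /dir cabs_expi divr1. Qed.

End Direction.

Lemma expi_atan (R : realType) (z : R[i]) : 0 < complex.Re z ->
  expi (atan (complex.Im z / complex.Re z)) = z / (cabs z)%:C.
Proof.
case: z => x y /= x0; have z0 : 0 < cabs (x +i* y).
  by rewrite cabs_gt0; apply/eqP => -[xE _]; rewrite xE ltxx in x0.
have e : cos (atan (y / x)) = x / cabs (x +i* y).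
  rewrite cos_atan cabsE /nsq /=.
  have -> : 1 + (y / x) ^+ 2 = (x ^+ 2 + y ^+ 2) / x ^+ 2 by field; rewrite gt_eqF.
  rewrite sqrtrM ?addr_ge0 ?sqr_ge0// sqrtrV ?sqr_ge0// sqrtr_sqr gtr0_norm// invfM invrK mulrC//.
have c0 : cos (atan (y / x)) != 0 by rewrite e gt_eqF// divr_gt0.
have e' : sin (atan (y / x)) = y / cabs (x +i* y).
  have := atanK (y / x); rewrite /tan => /(canRL (divfK c0)) ->; rewrite e.
  by field; rewrite gt_eqF//= gt_eqF.
by rewrite /expi e e' -fmorphV; apply: complex_eqP => /=; ring.
Qed.

Section LogarithmicDerivative.
Context {R : realType}.
Implicit Types (F G : 'rV[R]_2 -> R[i]) (u : 'rV[R]_2).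

(** Here h is F'/F, which adds under products and changes sign under inversion. *)
Definition dlog F u (h : R[i]) := F u != 0 /\ cdiff F u (F u * h).

Lemma dlog_pole (z : R[i]) u : cplx u != z -> dlog (fun v => cplx v - z) u (cplx u - z)^-1.
Proof.
move=> uz; have uz0 : cplx u - z != 0 by rewrite subr_eq0.
split=> //; apply: cdiff_eq (cdiffB (cdiff_cplx u) (cdiff_cst z u)) => //.
by rewrite subr0 mulfV.
Qed.

Lemma dlogM F G u h k : dlog F u h -> dlog G u k -> dlog (fun v => F v * G v) u (h + k).
Proof.
move=> [F0 dF] [G0 dG]; split; first by rewrite mulf_neq0.
by apply: cdiff_eq (cdiffM dF dG) => //; ring.
Qed.

Lemma dlogV F u h : dlog F u h -> dlog (fun v => (F v)^-1) u (- h).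
Proof.
move=> [F0 dF]; split; first by rewrite invr_eq0.
by apply: cdiff_eq (cdiffV F0 dF) => //; field.
Qed.

Lemma dlogZ (a : R[i]) F u h : a != 0 -> dlog F u h -> dlog (fun v => a * F v) u h.
Proof.
move=> a0 [F0 dF]; split; first by rewrite mulf_neq0.
by apply: cdiff_eq (cdiffZ a dF) => //; rewrite mulrA.
Qed.

End LogarithmicDerivative.

(** * The rational functions behind X, Y, Z and their symmetries *)

Section TowerFunctions.
Context {R : realType} (phi theta : R).
Implicit Types w : R[i].
Let p : R[i] := expi phi.
Let q : R[i] := expi (- phi).

(** X and Y are combinations of the logarithms of |[facX]|, |[facI]| and |[facY]|, while [facZ] is
    the function R with e^(iZ) = R/|R|. The sign in [facZ] gives R(0) = 1, matching Z(0) = 0. *)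
Definition facX w := (w + p) * (w + q) / ((w - p) * (w - q)).
Definition facY w := (w - p) * (w + q) / ((w + p) * (w - q)).
Definition facI w : R[i] := (w - 'i) / (w + 'i).
Definition facZ w := - facY w / facI w.

Lemma expi_mulN : p * q = 1.
Proof. by rewrite -expiD subrr expi0. Qed.

Lemma puncturesP w : w \notin punctures phi ->
  [/\ w - p != 0, w + p != 0, w - q != 0, w + q != 0 & w - 'i != 0 /\ w + 'i != 0].
Proof.
rewrite !inE !negb_or -/p -/q => /and5P[w1 w2 w3 w4 /andP[w5 w6]].
by rewrite !subr_eq0 !addr_eq0.
Qed.

Lemma fac_neq0 w : w \notin punctures phi ->
  [/\ facX w != 0, facY w != 0, facI w != 0 & facZ w != 0].
Proof.
move=> /puncturesP[? ? ? ? [? ?]].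
have Y0 : facY w != 0 by rewrite mulf_neq0 ?invr_eq0 ?mulf_neq0.
have I0 : facI w != 0 by rewrite mulf_neq0 ?invr_eq0 ?mulf_neq0.
have X0 : facX w != 0 by rewrite mulf_neq0 ?invr_eq0 ?mulf_neq0.
by split=> //; rewrite mulf_neq0 ?invr_eq0 ?oppr_eq0.
Qed.

Lemma towXE w : towX phi theta w = sin theta * ln (cabs (facX w)).
Proof. by rewrite /towX /facX !(cabsM, cabsV) -/p -/q. Qed.

Lemma towYE w : towY phi theta w = ln (cabs (facI w)) + cos theta * ln (cabs (facY w)).
Proof. by rewrite /towY /facI /facY !(cabsM, cabsV) -/p -/q. Qed.

(** [expi] turns the signed sum of arguments into a product of directions, and the jumps by 2 pi
    disappear. *)
Lemma expi_towZ w : w \notin punctures phi -> expi (towZ phi w) = facZ w / (cabs (facZ w))%:C.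
Proof.
move=> wP; have [w1 w2 w3 w4 [w5 w6]] := puncturesP wP.
have p0 : p != 0 by exact: expi_neq0.
have q0 : q != 0 by exact: expi_neq0.
have i0 : 'i != 0 :> R[i] by exact: neq0Ci.
have w1' : p - w != 0 by rewrite -oppr_eq0 opprB.
have w2' : - p - w != 0 by rewrite -oppr_eq0 opprB opprK.
have w3' : q - w != 0 by rewrite -oppr_eq0 opprB.
have w4' : - q - w != 0 by rewrite -oppr_eq0 opprB opprK.
have w5' : 'i - w != 0 by rewrite -oppr_eq0 opprB.
have w6' : - 'i - w != 0 by rewrite -oppr_eq0 opprB opprK.
rewrite /towZ /signs !big_cons !big_nil !mul1r !mulN1r !opprK !addr0 !rmorphN !mul1r !mulN1r -/p -/q.
rewrite !(expiD, expiN) !expi_Arg -/(dir _).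
  rewrite -!(dirM, dirV) -/(dir (facZ w)); congr dir.
  rewrite /facZ /facY /facI; field.
  by rewrite p0 q0 i0 w2' w3' w5' w6' w2 w3 w5 w6.
all: by rewrite mulf_neq0 ?invr_eq0 ?oppr_eq0 //.
Qed.

(** Inversion exchanges p with q, since p q = 1, and i with -i. *)
Lemma fac_inv w : w != 0 -> w \notin punctures phi ->
  [/\ facX w^-1 = facX w, facY w^-1 = (facY w)^-1, facI w^-1 = - (facI w)^-1 &
      facZ w^-1 = - (facZ w)^-1].
Proof.
move=> w0 wP; have [w1 w2 w3 w4 [w5 w6]] := puncturesP wP.
have p0 : p != 0 by exact: expi_neq0.
have q0 : q != 0 by exact: expi_neq0.
have qE : q = p^-1 by rewrite /q expiN.
have ii : 'i * 'i = -1 :> R[i] by rewrite -expr2 sqrCi.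
have i0 : 'i != 0 :> R[i] by exact: neq0Ci.
have iV : ('i : R[i]) = - 'i^-1 by apply: (mulfI i0); rewrite ii mulrN mulfV.
have ww (a b : R[i]) : a != 0 -> b = a^-1 -> w^-1 - a = - a * w^-1 * (w - b).
  by move=> a0 ->; field; rewrite ?w0 ?a0.
have ww' (a b : R[i]) : a != 0 -> b = a^-1 -> w^-1 + a = a * w^-1 * (w + b).
  by move=> a0 ->; field; rewrite ?w0 ?a0.
have pE : p = q^-1 by rewrite qE invrK.
have iE : - 'i = 'i^-1 :> R[i] by rewrite {1}iV opprK.
have EX : facX w^-1 = facX w.
  rewrite /facX (ww p q)// (ww q p)// (ww' p q)// (ww' q p)//.
  by field; rewrite w3 w1 w0 p0 q0.
have EY : facY w^-1 = (facY w)^-1.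
  rewrite /facY (ww p q)// (ww q p)// (ww' p q)// (ww' q p)//.
  by field; rewrite w1 w2 w3 w4 w0 p0 q0.
have EI : facI w^-1 = - (facI w)^-1.
  rewrite /facI (ww 'i (-'i))// (ww' 'i (-'i))// opprK.
  by field; rewrite w5 w6 w0 i0.
split=> //; rewrite /facZ EY EI.
have [_ Y0 I0 _] := fac_neq0 wP.
by field; rewrite Y0 I0.
Qed.

Lemma expi_conj (t : R) : (expi t)^*%C = expi (- t).
Proof. by rewrite /expi cosN sinN. Qed.

Lemma iconj : ('i : R[i])^*%C = - 'i.
Proof. by rewrite -complexiE; apply: complex_eqP => /=; rewrite ?oppr0. Qed.

(** Conjugation exchanges p with q and i with -i as well; this is the reflection through x = 0
    upstairs. *)
Lemma fac_conj w : w \notin punctures phi ->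
  [/\ facX w^*%C = (facX w)^*%C, facY w^*%C = ((facY w)^-1)^*%C, facI w^*%C = ((facI w)^-1)^*%C &
      facZ w^*%C = ((facZ w)^-1)^*%C].
Proof.
move=> wP; have [w1 w2 w3 w4 [w5 w6]] := puncturesP wP.
have pc : p^*%C = q by rewrite expi_conj.
have qc : q^*%C = p by rewrite expi_conj opprK.
have EX : facX w^*%C = (facX w)^*%C.
  rewrite /facX !(conjcM, conjc_inv, conjcD, conjcN) pc qc.
  by congr (_ / _); rewrite mulrC.
have EY : facY w^*%C = ((facY w)^-1)^*%C.
  rewrite /facY invf_div !(conjcM, conjc_inv, conjcD, conjcN) pc qc.
  by rewrite [X in X / _]mulrC; congr (_ / _); rewrite mulrC.
have EI : facI w^*%C = ((facI w)^-1)^*%C.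
  by rewrite /facI invf_div !(conjcM, conjc_inv, conjcD, conjcN) iconj opprK.
split=> //; rewrite /facZ EY EI !(invfM, invrN, conjcM, conjc_inv, conjcN) //.
Qed.

Lemma punctures_inv w : (w^-1 \in punctures phi) = (w \in punctures phi).
Proof.
have inv_sub (z : R[i]) : z \in punctures phi -> z^-1 \in punctures phi.
  rewrite !inE -/p -/q => /or4P[/eqP->|/eqP->|/eqP->|/or3P[/eqP->|/eqP->|/eqP->]];
  rewrite ?invrN ?invCi ?opprK ?/p ?/q -?expiN ?opprK eqxx ?orbT//.
by apply/idP/idP => [/inv_sub|/inv_sub//]; rewrite invrK.
Qed.

Lemma punctures_conj w : (w^*%C \in punctures phi) = (w \in punctures phi).
Proof.
have conj_sub (z : R[i]) : z \in punctures phi -> z^*%C \in punctures phi.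
  rewrite !inE -/p -/q => /or4P[/eqP->|/eqP->|/eqP->|/or3P[/eqP->|/eqP->|/eqP->]];
  rewrite ?conjcN ?iconj ?opprK ?expi_conj ?opprK eqxx ?orbT//.
by apply/idP/idP => [/conj_sub|/conj_sub//]; rewrite conjcK.
Qed.

End TowerFunctions.

(** With D the product of the four factors at +-p and +-q, the factor w^2 + 1 of LY cancels the
    denominator of LI, and LY^2 - LX^2 collapses to -16 p q / D. Both sides are then -16 s / D. *)
Lemma null_identity (F : fieldType) (w p q i s : F) :
  p * q = 1 -> i * i = -1 -> p - q = 2 * i * s ->
  w - p != 0 -> w + p != 0 -> w - q != 0 -> w + q != 0 -> w - i != 0 -> w + i != 0 ->
  let LI := (w - i)^-1 - (w + i)^-1 in
  let LY := (w - p)^-1 + (w + q)^-1 - (w + p)^-1 - (w - q)^-1 in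
  let LX := (w + p)^-1 + (w + q)^-1 - (w - p)^-1 - (w - q)^-1 in
  2 * LI * LY = s * (LY ^+ 2 - LX ^+ 2).
Proof.
move=> pq ii pmq w1 w2 w3 w4 w5 w6 LI LY LX.
set D := (w - p) * (w + p) * (w - q) * (w + q).
have D0 : D != 0 by rewrite !mulf_neq0.
have W : (w - i) * (w + i) = w ^+ 2 + 1 by rewrite -subr_sqr expr2 [i ^+ 2]expr2 ii; ring.
have W0 : w ^+ 2 + 1 != 0 by rewrite -W mulf_neq0.
have LIE : LI = 2 * i / (w ^+ 2 + 1) by rewrite -W /LI; field; rewrite w5 w6.
have LYE : LY = 2 * (p - q) * (w ^+ 2 + p * q) / D.
  by rewrite /LY /D; field; rewrite w1 w2 w3 w4.
have LXE : LX = - 2 * (p + q) * (w ^+ 2 - p * q) / D.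
  by rewrite /LX /D; field; rewrite w1 w2 w3 w4.
have -> : LY ^+ 2 - LX ^+ 2 = - 16 * (p * q) / D.
  by rewrite LYE LXE /D; field; rewrite w1 w2 w3 w4.
rewrite LIE LYE pq pmq.
have -> : 2 * (2 * i / (w ^+ 2 + 1)) * (2 * (2 * i * s) * (w ^+ 2 + 1) / D) = 16 * (i * i) * s / D.
  by field; rewrite W0 D0.
by rewrite ii; ring.
Qed.

(** * Stereographic coordinates and injectivity of (X, Y) up to inversion *)

Section Stereographic.
Context {R : realType}.
Implicit Types (w : R[i]) (x y s c a b C : R).

Definition stx w : R := 2 * complex.Re w / (1 + nsq w).
Definition sty w : R := 2 * complex.Im w / (1 + nsq w).

Lemma nsqBexpi w t : nsq (w - expi t) = (1 + nsq w) * (1 - stx w * cos t - sty w * sin t).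
Proof.
have n0 : 1 + nsq w != 0 by rewrite gt_eqF// ltr_pwDl// nsq_ge0.
transitivity ((1 + nsq w) - 2 * complex.Re w * cos t - 2 * complex.Im w * sin t).
  have := cos2Dsin2 t; rewrite /expi; move: (cos t) (sin t) => c s cs.
  case: w {n0} => a b; rewrite /nsq /=.
  transitivity (c ^+ 2 + s ^+ 2 + (a ^+ 2 + b ^+ 2) - 2 * a * c - 2 * b * s); first by ring.
  by rewrite cs.
by rewrite /stx /sty; field.
Qed.

(** Twice the inverse hyperbolic tangent. *)
Definition lr x := ln ((1 + x) / (1 - x)).

Lemma lr_lt x y : -1 < x -> x < y -> y < 1 -> lr x < lr y.
Proof.
move=> x1 xy y1.
have [hx1 hx2 hy1 hy2] : [/\ 0 < 1 + x, 0 < 1 - x, 0 < 1 + y & 0 < 1 - y] by split; lra.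
rewrite /lr ltr_ln ?posrE ?divr_gt0// ltr_pdivrMr// mulrAC ltr_pdivlMr//.
lra.
Qed.

Lemma lr_le x y : -1 < x < 1 -> -1 < y < 1 -> lr x < lr y -> x < y.
Proof.
move=> /andP[x0 x1] /andP[y0 y1]; apply: contraTT; rewrite -!leNgt le_eqVlt.
by move=> /predU1P[->//|yx]; apply/ltW/lr_lt.
Qed.

Lemma lr_inj x y : -1 < x < 1 -> -1 < y < 1 -> lr x = lr y -> x = y.
Proof.
move=> /andP[x0 x1] /andP[y0 y1] xy; case: (ltrgtP x y) => // h.
  by have := lr_lt x0 h y1; rewrite xy ltxx.
by have := lr_lt y0 h x1; rewrite xy ltxx.
Qed.

(* In stereographic coordinates both level conditions are sums of the increasing
   function [lr]: b1 < b2 would force ac - bs up and ac + bs down. *)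
Lemma stereo_inj C s c a1 b1 a2 b2 : 0 < C -> 0 < s -> c != 0 ->
  -1 < a1 * c + b1 * s < 1 -> -1 < a1 * c - b1 * s < 1 -> -1 < b1 < 1 ->
  -1 < a2 * c + b2 * s < 1 -> -1 < a2 * c - b2 * s < 1 -> -1 < b2 < 1 ->
  lr (a1 * c + b1 * s) + lr (a1 * c - b1 * s) = lr (a2 * c + b2 * s) + lr (a2 * c - b2 * s) ->
  - lr b1 + C * (lr (a1 * c - b1 * s) - lr (a1 * c + b1 * s)) =
  - lr b2 + C * (lr (a2 * c - b2 * s) - lr (a2 * c + b2 * s)) ->
  a1 = a2 /\ b1 = b2.
Proof.
move=> C0 s0 c0.
(* Stated for arbitrary pairs, because b1 = b2 comes from using the inequality in both orders. *)
have mono x1 y1 x2 y2 : -1 < x1 * c + y1 * s < 1 -> -1 < x1 * c - y1 * s < 1 -> -1 < y1 < 1 ->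
    -1 < x2 * c + y2 * s < 1 -> -1 < x2 * c - y2 * s < 1 -> -1 < y2 < 1 ->
    lr (x1 * c + y1 * s) + lr (x1 * c - y1 * s) = lr (x2 * c + y2 * s) + lr (x2 * c - y2 * s) ->
    - lr y1 + C * (lr (x1 * c - y1 * s) - lr (x1 * c + y1 * s)) =
    - lr y2 + C * (lr (x2 * c - y2 * s) - lr (x2 * c + y2 * s)) -> y2 <= y1.
  move=> p1 q1 /andP[h1 h1'] p2 q2 /andP[h2 h2'] eX eY; rewrite leNgt; apply/negP => y12.
  have l12 := lr_lt h1 y12 h2'.
  have : C * (lr (x1 * c - y1 * s) - lr (x1 * c + y1 * s)) <
         C * (lr (x2 * c - y2 * s) - lr (x2 * c + y2 * s)) by lra.
  rewrite ltr_pM2l// => D12.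
  have /(lr_le q1 q2) q12 : lr (x1 * c - y1 * s) < lr (x2 * c - y2 * s) by lra.
  have /(lr_le p2 p1) p12 : lr (x2 * c + y2 * s) < lr (x1 * c + y1 * s) by lra.
  have : y1 * s < y2 * s by rewrite ltr_pM2r.
  lra.
move=> p1 q1 h1 p2 q2 h2 eX eY.
have b12 : b1 = b2.
  by apply/eqP; rewrite eq_le (mono a2 b2 a1 b1)// (mono a1 b1 a2 b2).
(* Once the b's agree, both Q - P and P + Q agree, hence so does P; [c != 0] then recovers a. *)
split=> //; move: eY eX p1 q1; rewrite b12 => /addrI/(mulfI (lt0r_neq0 C0)) eD eX p1 q1.
have /(lr_inj p1 p2) : lr (a1 * c + b2 * s) = lr (a2 * c + b2 * s) by lra.
by move=> /addIr/(mulIf c0).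
Qed.

Lemma nsq_mul_inv (z z' : R[i]) : nsq (z / z') = nsq z / nsq z'.
Proof. by rewrite nsqM nsqV. Qed.

Lemma ln_cabs (z : R[i]) : ln (cabs z) = 2^-1 * ln (nsq z).
Proof.
have [->|z0] := eqVneq z 0; first by rewrite cabsE /nsq /= expr0n/= addr0 sqrtr0 ln0// mulr0.
have c0 : 0 < cabs z by rewrite cabs_gt0.
by rewrite -cabs_sqr lnXn// -[ln _ *+ 2]mulr_natl mulrA mulVf ?mul1r.
Qed.

End Stereographic.

Section TowerInjectivity.
Context {R : realType} (phi theta : R) (hphi : 0 < phi < pi / 2) (htheta : 0 < theta < pi / 2).
Implicit Types w : R[i].
Let p : R[i] := expi phi.
Let q : R[i] := expi (- phi).
Let s := sin phi.
Let c := cos phi.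

Lemma expiDpi (t : R) : expi (t + pi) = - expi t.
Proof. by rewrite /expi cosDpi sinDpi. Qed.

Lemma imag_expi : 'i = expi (pi / 2) :> R[i].
Proof. by rewrite -complexiE /expi cos_pihalf sin_pihalf. Qed.

(** Each of the six bounds is positivity of one squared distance to a puncture, divided by 1 +
    |w|^2; the opposite puncture is reached by adding pi to the angle. *)
Lemma stereo_range w : w \notin punctures phi ->
  [/\ -1 < stx w * c + sty w * s < 1, -1 < stx w * c - sty w * s < 1 & -1 < sty w < 1].
Proof.
move=> /puncturesP[w1 w2 w3 w4 [w5 w6]].
have n0 : 0 < 1 + nsq w by rewrite ltr_pwDl// nsq_ge0.
have pos t : w - expi t != 0 -> 0 < 1 - stx w * cos t - sty w * sin t.
  by rewrite -nsq_gt0 nsqBexpi pmulr_rgt0.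
have := pos _ w1; have := pos _ w3; rewrite cosN sinN.
have := pos (pi / 2); rewrite -imag_expi cos_pihalf sin_pihalf => /(_ w5).
have pos' t : w + expi t != 0 -> 0 < 1 + stx w * cos t + sty w * sin t.
  by move=> wt; have := pos (t + pi); rewrite expiDpi opprK cosDpi sinDpi => /(_ wt); rewrite !mulrN !opprK.
have := pos' _ w2; have := pos' _ w4; rewrite cosN sinN.
have := pos' (pi / 2); rewrite -imag_expi cos_pihalf sin_pihalf => /(_ w6).
rewrite /s /c; move: (stx w * cos phi) (sty w * sin phi) (sty w) (stx w) => *.
split; apply/andP; split; lra.
Qed.

Lemma tow_stereo w : w \notin punctures phi ->
  towX phi theta w = sin theta * (2^-1 * (lr (stx w * c + sty w * s) + lr (stx w * c - sty w * s))) /\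
  towY phi theta w = 2^-1 * (- lr (sty w) +
     cos theta * (lr (stx w * c - sty w * s) - lr (stx w * c + sty w * s))).
Proof.
move=> wP; have [/andP[r1 r2] /andP[r3 r4] /andP[r5 r6]] := stereo_range wP.
have n0 : 1 + nsq w != 0 by rewrite gt_eqF// ltr_pwDl// nsq_ge0.
have np : nsq (w - p) = (1 + nsq w) * (1 - (stx w * c + sty w * s)).
  by rewrite nsqBexpi /s /c; ring.
have nq : nsq (w - q) = (1 + nsq w) * (1 - (stx w * c - sty w * s)).
  by rewrite nsqBexpi cosN sinN /s /c; ring.
have np' : nsq (w + p) = (1 + nsq w) * (1 + (stx w * c + sty w * s)).
  by rewrite -[p]opprK -expiDpi nsqBexpi cosDpi sinDpi /s /c; ring.
have nq' : nsq (w + q) = (1 + nsq w) * (1 + (stx w * c - sty w * s)).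
  by rewrite -[q]opprK -expiDpi nsqBexpi cosDpi sinDpi cosN sinN /s /c; ring.
have ni : nsq (w - 'i) = (1 + nsq w) * (1 - sty w).
  by rewrite imag_expi nsqBexpi cos_pihalf sin_pihalf /s /c; ring.
have ni' : nsq (w + 'i) = (1 + nsq w) * (1 + sty w).
  by rewrite -['i]opprK imag_expi -expiDpi nsqBexpi cosDpi sinDpi cos_pihalf sin_pihalf /s /c; ring.
rewrite towXE towYE !ln_cabs /facX /facY /facI !nsq_mul_inv !nsqM -/p -/q np nq np' nq' ni ni' /lr.
move: r1 r2 r3 r4 r5 r6; set P := stx w * c + _; set Q := stx w * c - _; set b := sty w => r1 r2 r3 r4 r5 r6.
have [h1 h2 h3 h4] : [/\ 0 < 1 + P, 0 < 1 - P, 0 < 1 + Q & 0 < 1 - Q] by split; lra.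
have [h5 h6] : 0 < 1 + b /\ 0 < 1 - b by split; lra.
have -> : (1 + nsq w) * (1 + P) * ((1 + nsq w) * (1 + Q)) / ((1 + nsq w) * (1 - P) * ((1 + nsq w) * (1 - Q)))
   = ((1 + P) / (1 - P)) * ((1 + Q) / (1 - Q)) by field; rewrite n0 !gt_eqF.
have -> : (1 + nsq w) * (1 - P) * ((1 + nsq w) * (1 + Q)) / ((1 + nsq w) * (1 + P) * ((1 + nsq w) * (1 - Q)))
   = ((1 - P) / (1 + P)) * ((1 + Q) / (1 - Q)) by field; rewrite n0 !gt_eqF.
have -> : (1 + nsq w) * (1 - b) / ((1 + nsq w) * (1 + b)) = (1 - b) / (1 + b) by field; rewrite n0 !gt_eqF.
by rewrite !lnM ?lnV ?posrE ?divr_gt0 ?mulr_gt0 ?invr_gt0//; split; ring.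
Qed.

Lemma sin_cos_pos : 0 < s /\ 0 < c.
Proof.
split; first exact: sin_gt0_pihalf.
by apply: cos_gt0_pihalf; case/andP: hphi => h ->; rewrite andbT; apply: lt_trans h; rewrite oppr_lt0 divr_gt0 ?pi_gt0.
Qed.

Lemma tow_inj w1 w2 : w1 \notin punctures phi -> w2 \notin punctures phi ->
  towX phi theta w1 = towX phi theta w2 -> towY phi theta w1 = towY phi theta w2 ->
  stx w1 = stx w2 /\ sty w1 = sty w2.
Proof.
move=> P1 P2; have [X1 Y1] := tow_stereo P1; have [X2 Y2] := tow_stereo P2.
have [s0 c0] := sin_cos_pos.
have st : 0 < sin theta by exact: sin_gt0_pihalf.
have ct : 0 < cos theta.
  by apply: cos_gt0_pihalf; case/andP: htheta => h ->; rewrite andbT; apply: lt_trans h; rewrite oppr_lt0 divr_gt0 ?pi_gt0.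
have h2 : 2^-1 != 0 :> R by rewrite invr_eq0.
rewrite X1 X2 Y1 Y2 => /(mulfI (lt0r_neq0 st))/(mulfI h2) eX /(mulfI h2) eY.
have [r1 r2 r3] := stereo_range P1; have [r4 r5 r6] := stereo_range P2.
exact: stereo_inj ct s0 (lt0r_neq0 c0) r1 r2 r3 r4 r5 r6 eX eY.
Qed.

Lemma stereo_eq w1 w2 : stx w1 = stx w2 -> sty w1 = sty w2 ->
  w1 = w2 \/ w2 = (w1^*%C)^-1 /\ w1 != 0.
Proof.
move=> ex ey.
have [n1 n2] : 0 < 1 + nsq w1 /\ 0 < 1 + nsq w2 by rewrite !ltr_pwDl// nsq_ge0.
have exy (u1 u2 : R) : 2 * u1 / (1 + nsq w1) = 2 * u2 / (1 + nsq w2) -> u1 * (1 + nsq w2) = u2 * (1 + nsq w1).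
  by move/eqP; rewrite eqr_div ?lt0r_neq0// -!mulrA => /eqP/mulfI -> //; rewrite mulrC.
move: ex ey; rewrite /stx /sty => /exy ex /exy ey.
(* With n = |w1|^2 and m = |w2|^2 the difference of the sides is (n - m)(1 - n m): equal moduli give
   w1 = w2, and n m = 1 gives the inverse point. *)
have n : nsq w1 * (1 + nsq w2) ^+ 2 = nsq w2 * (1 + nsq w1) ^+ 2.
  by rewrite /nsq in ex ey *; rewrite !mulrDl -!exprMn ex ey.
have /eqP : (nsq w1 - nsq w2) * (1 - nsq w1 * nsq w2) = 0.
  by move/eqP: n; rewrite -subr_eq0 => /eqP n; rewrite -[RHS]n; ring.
rewrite mulf_eq0 => /orP[]; rewrite subr_eq0 => /eqP e.
  left; apply: complex_eqP; apply: (@mulIf _ (1 + nsq w1)); rewrite ?lt0r_neq0//.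
    by rewrite -ex e.
  by rewrite -ey e.
have w10 : w1 != 0.
  by apply/eqP => w10; move: e; rewrite w10 {1}/nsq /= expr0n/= addr0 mul0r => /eqP; rewrite oner_eq0.
right; split=> //; have nw1 : nsq w1 != 0 by rewrite lt0r_neq0// nsq_gt0.
have n2E : nsq w2 = (nsq w1)^-1 by apply: (mulfI nw1); rewrite -e mulfV.
rewrite complex_invE; have -> : nsq w1^*%C = nsq w1 by case: (w1) => a b; rewrite /nsq /= sqrrN.
move: ex ey; rewrite n2E.
have -> : 1 + (nsq w1)^-1 = (1 + nsq w1) / nsq w1 by field.
rewrite mulrA mulrAC => /(mulIf (lt0r_neq0 n1)) ex.
rewrite mulrA mulrAC => /(mulIf (lt0r_neq0 n1)) ey.
by apply: complex_eqP; rewrite -?ex -?ey; case: (w1) => a b /=; rewrite ?mulNr ?opprK.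
Qed.

Lemma expiB_sin : p - q = 0 +i* (2 * s).
Proof. by rewrite /p /q /expi cosN sinN; apply: complex_eqP => /=; rewrite /s; ring. Qed.

(* Re facZ is a positive multiple of 1 - |w|^2. *)
Lemma Re_facZ_eq0 w : w \notin punctures phi -> complex.Re (facZ phi w) = 0 -> nsq w = 1.
Proof.
move=> wP; have [w1 w2 w3 w4 [w5 w6]] := puncturesP wP.
set num := - ((w - p) * (w + q) * (w + 'i)); set den := (w + p) * (w - q) * (w - 'i).
have den0 : den != 0 by rewrite !mulf_neq0.
have -> : facZ phi w = num / den by rewrite /facZ /facY /facI /num /den -/p -/q; field; rewrite w2 w3 w5 w6.
have pq : p * q = 1 by rewrite expi_mulN.
have numE : num = - ((w * w - 1 - (0 +i* (2 * s)) * w) * (w + (0 +i* 1))).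
  by rewrite /num -expiB_sin -pq -complexiE; ring.
have denE : den = (w * w - 1 + (0 +i* (2 * s)) * w) * (w - (0 +i* 1)).
  by rewrite /den -expiB_sin -pq -complexiE; ring.
have n0 : nsq den != 0 by rewrite lt0r_neq0// nsq_gt0.
have ReE : complex.Re (num / den) = complex.Re (num * den^*%C) / nsq den.
  by rewrite complex_invE; case: (num) (den) => [? ?] [? ?] /=; ring.
rewrite ReE => /(canRL (mulfVK n0)); rewrite mul0r numE denE.
have [s0 c0] := sin_cos_pos.
have s1 : s < 1 by have := cos2Dsin2 phi; rewrite -/s -/c; nra.
case: w {wP w1 w2 w3 w4 w5 w6 num den den0 numE denE n0 ReE} => x y; rewrite /nsq /=.
set n := x ^+ 2 + y ^+ 2.
set K := (n + 1) ^+ 2 - 4 * x ^+ 2 - 4 * s ^+ 2 * n + 8 * s * x ^+ 2.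
have K0 : 0 < K.
  (* For 0 < s < 1 all three terms are nonnegative, and at x = y = 0, where the last two vanish, the
     first equals 1. *)
  have -> : K = (1 - n) ^+ 2 + 4 * (y ^+ 2 * (1 - s ^+ 2)) + 4 * (x ^+ 2 * (s * (2 - s))).
    by rewrite /K /n; ring.
  have a0 : 0 < 1 - s ^+ 2 by rewrite subr_gt0 expr_lt1// ltW.
  have b0 : 0 < s * (2 - s) by rewrite mulr_gt0// subr_gt0; lra.
  have A0 := sqr_ge0 (1 - n).
  have B0 : 0 <= y ^+ 2 * (1 - s ^+ 2) by rewrite mulr_ge0 ?sqr_ge0// ltW.
  have C0 : 0 <= x ^+ 2 * (s * (2 - s)) by rewrite mulr_ge0 ?sqr_ge0// ltW.
  have [x0|x0] := eqVneq x 0; last first.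
    have : 0 < x ^+ 2 * (s * (2 - s)) by rewrite mulr_gt0// lt0r sqrf_eq0 x0 sqr_ge0.
    lra.
  have [y0|y0] := eqVneq y 0; first by move: B0 C0; rewrite /n x0 y0 expr0n/= addr0 subr0 expr1n; lra.
  have : 0 < y ^+ 2 * (1 - s ^+ 2) by rewrite mulr_gt0// lt0r sqrf_eq0 y0 sqr_ge0.
  lra.
move=> ReE; have /eqP : (1 - n) * K = 0 by rewrite -[RHS]ReE /K /n; ring.
by rewrite mulf_eq0 (gt_eqF K0) orbF subr_eq0 => /eqP.
Qed.

End TowerInjectivity.

(** * Local lifts of the tower and their Weierstrass data *)

Section TowerCharts.
Context {R : realType} (phi theta : R) (hphi : 0 < phi < pi / 2) (htheta : 0 < theta < pi / 2)
  (hcos : cos theta = 1 - sin phi).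
Implicit Types (u v : 'rV[R]_2) (w : R[i]).
Let p : R[i] := expi phi.
Let q : R[i] := expi (- phi).

Definition pole (z w : R[i]) : R[i] := (w - z)^-1.
Definition LX w : R[i] := pole (- p) w + pole (- q) w - pole p w - pole q w.
Definition LY w : R[i] := pole p w + pole (- q) w - pole (- p) w - pole q w.
Definition LI w : R[i] := pole 'i w - pole (- 'i) w.

(* The sign [a] is 1 in the chart w and -1 in the chart 1/w. *)
Definition towH (a : R) (j : 'I_3) u : R[i] :=
  [:: a%:C * (LI (cplx u) + (cos theta)%:C * LY (cplx u));
      (sin theta)%:C * LX (cplx u);
      a%:C * - 'i * (LY (cplx u) - LI (cplx u))]`_j.

(** Normalised to equal 1 at w0, so that near w0 it stays in the right half-plane, where the
    arctangent is a smooth argument. *)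
Definition localS w0 u : R[i] := facZ phi (cplx u) / facZ phi w0.

(** The constant b is the height at w0. Taking a = -1 reverses Y and Z, as the relation between w
    and 1/w requires. *)
Definition lift (a b : R) w0 u : 'rV[R]_3 :=
  vec3 (a * towY phi theta (cplx u)) (towX phi theta (cplx u))
       (b + a * atan (complex.Im (localS w0 u) / complex.Re (localS w0 u))).

Definition regular : set 'rV[R]_2 := [set u | cplx u \notin punctures phi].

Definition lift_dom w0 : set 'rV[R]_2 := [set u | regular u /\ 0 < complex.Re (localS w0 u)].

Lemma dlog_fac u : regular u ->
  [/\ dlog (fun v => facX phi (cplx v)) u (LX (cplx u)),
      dlog (fun v => facY phi (cplx v)) u (LY (cplx u)),
      dlog (fun v => facI (cplx v)) u (LI (cplx u)) &
      dlog (fun v => facZ phi (cplx v)) u (LY (cplx u) - LI (cplx u))].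
Proof.
move=> /puncturesP[w1 w2 w3 w4 [w5 w6]].
have d1 : dlog (fun v => cplx v - p) u (pole p (cplx u)) by apply: dlog_pole; rewrite -subr_eq0.
have d2 : dlog (fun v => cplx v + p) u (pole (- p) (cplx u)).
  have := @dlog_pole _ (- p) u; rewrite -subr_eq0 opprK => /(_ w2).
  by rewrite /pole opprK.
have d3 : dlog (fun v => cplx v - q) u (pole q (cplx u)) by apply: dlog_pole; rewrite -subr_eq0.
have d4 : dlog (fun v => cplx v + q) u (pole (- q) (cplx u)).
  have := @dlog_pole _ (- q) u; rewrite -subr_eq0 opprK => /(_ w4).
  by rewrite /pole opprK.
have d5 : dlog (fun v => cplx v - 'i) u (pole 'i (cplx u)) by apply: dlog_pole; rewrite -subr_eq0.
have d6 : dlog (fun v => cplx v + 'i) u (pole (- 'i) (cplx u)).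
  have := @dlog_pole _ (- 'i) u; rewrite -subr_eq0 opprK => /(_ w6).
  by rewrite /pole opprK.
have dX : dlog (fun v => facX phi (cplx v)) u (LX (cplx u)).
  by have := dlogM (dlogM d2 d4) (dlogV (dlogM d1 d3)); rewrite /LX opprD addrA.
have dY : dlog (fun v => facY phi (cplx v)) u (LY (cplx u)).
  by have := dlogM (dlogM d1 d4) (dlogV (dlogM d2 d3)); rewrite /LY opprD addrA.
have dI : dlog (fun v => facI (cplx v)) u (LI (cplx u)).
  exact: (dlogM d5 (dlogV d6)).
split=> //; have := dlogM (dlogZ (a := -1) _ dY) (dlogV dI).
rewrite oppr_eq0 oner_eq0 => /(_ isT).
rewrite (_ : (fun v => -1 * facY phi (cplx v) * _) = fun v => facZ phi (cplx v))//.
by apply/funext => v; rewrite /facZ mulN1r.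
Qed.

Lemma open_regular : open regular.
Proof.
rewrite openE => u; rewrite /regular /= => uP.
have nb (z : R[i]) : cplx u != z -> \forall v \near u, cplx v != z.
  by move=> uz; exact: cplx_continuous (nbhs_neq uz).
move: uP; rewrite /punctures !inE !negb_or => /and5P[/nb n1 /nb n2 /nb n3 /nb n4 /andP[/nb n5 /nb n6]].
apply: filterS (filterI (filterI (filterI n1 n2) (filterI n3 n4)) (filterI n5 n6)).
by move=> v [[[h1 h2] [h3 h4]] [h5 h6]]; rewrite /= !inE !negb_or h1 h2 h3 h4 h5 h6.
Qed.

Lemma dlog_localS w0 u : w0 \notin punctures phi -> regular u ->
  dlog (localS w0) u (LY (cplx u) - LI (cplx u)).
Proof.
move=> w0P /dlog_fac[_ _ _ dZ]; have [_ _ _ Z0] := fac_neq0 w0P.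
have Z0' : (facZ phi w0)^-1 != 0 by rewrite invr_eq0.
by have := dlogZ Z0' dZ; rewrite /localS; under eq_fun do rewrite mulrC.
Qed.

Lemma open_lift_dom w0 : w0 \notin punctures phi -> open (lift_dom w0).
Proof.
move=> w0P; rewrite openE => u [uP Su].
have [_ [dS _]] := dlog_localS w0P uP.
have near_reg : nbhs u regular by apply: open_nbhs_nbhs; split=> //; exact: open_regular.
have nS : nbhs (complex.Re (localS w0 u)) [set x : R | 0 < x].
  by apply: open_nbhs_nbhs; split=> //; exact: open_gt.
exact: filterI near_reg (rdiff_continuous dS nS).
Qed.

Lemma lift_dom_center u : regular u -> lift_dom (cplx u) u.
Proof.
move=> uP; split=> //; have [_ _ _ Z0] := fac_neq0 uP.
by rewrite /localS mulfV//= ltr01.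
Qed.

Lemma weierstrass_lift a b w0 : w0 \notin punctures phi ->
  weierstrass (lift_dom w0) (lift a b w0) (towH a).
Proof.
move=> w0P j u [uP Su]; have [[X0 dX] [Y0 dY] [I0 dI] _] := dlog_fac uP.
have lX := rdiffZ (sin theta) (rdiff_ln_cabs X0 dX).
have lY := rdiffZ a (rdiffD (rdiff_ln_cabs I0 dI) (rdiffZ (cos theta) (rdiff_ln_cabs Y0 dY))).
have [S0 dS] := dlog_localS w0P uP.
have lZ := rdiffD (rdiff_cst b u) (rdiffZ a (rdiff_atan Su dS)).
case: j => -[|[|[|//]]] jlt; rewrite /towH /=.
- apply: rdiff_eq lY => [v|//]; rewrite /lift /vec3 !mxE /=.
  by rewrite towYE.
- apply: rdiff_eq lX => [v|//]; rewrite /lift /vec3 !mxE /=.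
  by rewrite towXE.
apply: rdiff_eq lZ => [v|]; first by rewrite /lift /vec3 !mxE.
rewrite add0r -mulrA; congr (_ * _); rewrite -complexiE.
by case: (LY _ - LI _) => x y; apply: complex_eqP => /=; ring.
Qed.

Lemma cdiffk_towH a j k : cdiffk k regular (towH a j).
Proof.
have kp (z : R[i]) : z \in punctures phi -> cdiffk k regular (fun u => pole z (cplx u)).
  by move=> zP; apply: cdiffk_pole => u; apply: contraTneq => ->; rewrite zP.
have kB : forall f g, cdiffk k regular f -> cdiffk k regular g -> cdiffk k regular (fun u => f u - g u).
  move=> f g kf kg; rewrite (_ : (fun u => f u - g u) = fun u => f u + -1 * g u).
    by apply: cdiffkD => //; exact: cdiffkZ.
  by apply/funext => u; rewrite mulN1r.
have kX : cdiffk k regular (fun u => LX (cplx u)).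
  by apply/kB; [apply/kB; [apply: cdiffkD|]|]; apply/kp; rewrite !inE eqxx ?orbT.
have kY : cdiffk k regular (fun u => LY (cplx u)).
  by apply/kB; [apply/kB; [apply: cdiffkD|]|]; apply/kp; rewrite !inE eqxx ?orbT.
have kI : cdiffk k regular (fun u => LI (cplx u)).
  by apply/kB; apply/kp; rewrite !inE eqxx ?orbT.
case: j => -[|[|[|//]]] jlt; rewrite /towH /=.
- by apply: cdiffkZ; apply: cdiffkD => //; exact: cdiffkZ.
- exact: cdiffkZ.
by apply: cdiffkZ; exact: kB.
Qed.

Lemma cdiffk_sub k (U V : set 'rV[R]_2) h : U `<=` V -> cdiffk k V h -> cdiffk k U h.
Proof.
move=> UV; elim: k h => //= k IH h [h' dh kh']; exists h'; last exact: IH.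
by move=> u /UV; exact: dh.
Qed.

Lemma towH_null a u : a * a = 1 -> regular u -> \sum_j towH a j u ^+ 2 = 0.
Proof.
move=> aa /puncturesP[w1 w2 w3 w4 [w5 w6]].
have := null_identity (s := (sin phi)%:C) (expi_mulN phi) _ _ w1 w2 w3 w4 w5 w6.
have ii : 'i * 'i = -1 :> R[i] by rewrite -expr2 sqrCi.
have pq : p - q = 2 * 'i * (sin phi)%:C.
  by rewrite /p /q /expi cosN sinN -complexiE; apply: complex_eqP => /=; ring.
move=> /(_ ii pq); rewrite -/p -/q => nul.
have {}nul : 2 * LI (cplx u) * LY (cplx u) =
    (sin phi)%:C * (LY (cplx u) ^+ 2 - LX (cplx u) ^+ 2).
  by rewrite /LI /LY /LX /pole !opprK.
have aaC : a%:C * a%:C = 1 :> R[i] by rewrite -rmorphM aa.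
have sE : (sin theta)%:C ^+ 2 = 1 - (cos theta)%:C ^+ 2 :> R[i].
  by rewrite -!rmorphXn sin2cos2 rmorphB.
have cE : (sin phi)%:C = 1 - (cos theta)%:C :> R[i].
  by rewrite hcos rmorphB rmorph1 opprB addrC subrK.
rewrite sum3 /towH /= !exprMn sE sqrrN sqrCi [a%:C ^+ 2]expr2 aaC.
rewrite cE in nul; move: (LI _) (LY _) (LX _) (cos theta)%:C nul => x y z t nul.
(* Since sin^2 theta = (1 - cos theta)(1 + cos theta), the sum of squares has the factor 1 + cos
   theta; the other factor is [null_identity] with sin phi written as 1 - cos theta. *)
transitivity ((1 + t) * (2 * x * y - (1 - t) * (y ^+ 2 - z ^+ 2))); first by ring.
by rewrite nul subrr mulr0.
Qed.

(** If the third entry vanishes then LY = LI and the first is +-(1 + cos theta) LI. Here 1 + cos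
    theta = 2 - sin phi > 0, and LI = 0 would force i = -i. *)
Lemma towH_neq0 a u : a * a = 1 -> regular u -> exists j, towH a j u != 0.
Proof.
move=> aa uP; apply: contrapT => nH.
have H0 j : towH a j u = 0 by apply/eqP/negPn/negP => Hj; apply: nH; exists j.
have a0 : a%:C != 0 :> R[i] by rewrite fmorph_eq0; apply/eqP => a0; move: aa; rewrite a0 mul0r => /esym/eqP; rewrite oner_eq0.
have i0 : - 'i != 0 :> R[i] by rewrite oppr_eq0 neq0Ci.
have := H0 (Ordinal (isT : 2 < 3)%N); rewrite /towH /= => /eqP.
rewrite !mulf_eq0 (negPf a0) (negPf i0) /= subr_eq0 => /eqP YI.
have := H0 0; rewrite /towH /= => /eqP; rewrite mulf_eq0 (negPf a0) /= YI.
rewrite -[X in X + _]mul1r -mulrDl mulf_eq0 => /orP[|].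
  have -> : 1 + (cos theta)%:C = (1 + cos theta)%:C :> R[i] by rewrite rmorphD.
  rewrite fmorph_eq0 hcos => /eqP e.
  have : sin phi <= 1 by exact: sin_le1.
  lra.
rewrite /LI /pole opprK subr_eq0 => /eqP/invr_inj/addrI/esym/eqP.
by rewrite -addr_eq0 -mulr2n mulrn_eq0/= (negPf (neq0Ci R[i])).
Qed.

Section LiftProperties.
Context (a b : R) (w0 : R[i]) (aa : a * a = 1) (w0P : w0 \notin punctures phi).

Let sub_regular : lift_dom w0 `<=` regular.
Proof. by move=> u []. Qed.

Lemma smooth_lift : smooth (lift_dom w0) (lift a b w0).
Proof.
apply: smooth_weierstrass (open_lift_dom w0P) (weierstrass_lift a b w0P) _ => j k.
exact: cdiffk_sub sub_regular (cdiffk_towH a j k).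
Qed.

Lemma immersed_lift : immersed (lift_dom w0) (lift a b w0).
Proof.
apply: immersed_weierstrass (weierstrass_lift a b w0P) _ _ => u [uP _].
  exact: towH_null.
exact: towH_neq0.
Qed.

Lemma mean_curvature_lift u : lift_dom w0 u -> mean_curvature (lift a b w0) u = 0.
Proof.
apply: mean_curvature_weierstrass (weierstrass_lift a b w0P) _ (open_lift_dom w0P) _ _.
  by move=> v [vP _]; exact: towH_null.
by move=> j; exact: cdiffk_sub sub_regular (cdiffk_towH a j 1).
Qed.

End LiftProperties.
End TowerCharts.

(** * The map on the punctured sphere *)

Section TowerMap.
Context {R : realType} (phi theta : R) (hphi : 0 < phi < pi / 2) (htheta : 0 < theta < pi / 2)
  (hcos : cos theta = 1 - sin phi).
Implicit Types (u v : 'rV[R]_2) (w z : R[i]).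
Let p : R[i] := expi phi.
Let q : R[i] := expi (- phi).
Let D : set (rsphere R) := punctured_sphere phi.

(** The value at infinity is forced by G(1/w) = (-Y, X, pi - Z)(w), since X, Y and Z vanish at w =
    0. *)
Definition towG (o : rsphere R) : quot3 R :=
  if o is Some w then qproj (towF phi theta w) else qproj (vec3 0 0 pi).

Lemma cx_vec3 (a b c : R) : cx (vec3 a b c) = a.
Proof. by rewrite /cx mxE. Qed.
Lemma cy_vec3 (a b c : R) : cy (vec3 a b c) = b.
Proof. by rewrite /cy mxE. Qed.
Lemma cz_vec3 (a b c : R) : cz (vec3 a b c) = c.
Proof. by rewrite /cz mxE. Qed.

Lemma cabs_opp z : cabs (- z) = cabs z.
Proof. by rewrite /cabs normrN. Qed.

Lemma expi_pi : expi pi = -1 :> R[i].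
Proof. by rewrite /expi cospi sinpi; apply: complex_eqP => /=; rewrite ?oppr0. Qed.

Lemma tow_inv w : w != 0 -> w \notin punctures phi ->
  [/\ towX phi theta w^-1 = towX phi theta w, towY phi theta w^-1 = - towY phi theta w &
      expi (towZ phi w^-1) = - (expi (towZ phi w))^-1].
Proof.
move=> w0 wP; have [X0 Y0 I0 Z0] := fac_neq0 wP.
have [eX eY eI eZ] := fac_inv w0 wP.
have lnV' z : z != 0 -> ln (cabs z^-1) = - ln (cabs z).
  by move=> z0; rewrite cabsV lnV// posrE cabs_gt0.
split.
- by rewrite !towXE eX.
- by rewrite !towYE eY eI cabs_opp !lnV'//; ring.
by rewrite !expi_towZ ?punctures_inv// eZ -!/(dir _) dirN dirV.
Qed.

Lemma tow_conj w : w \notin punctures phi ->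
  [/\ towX phi theta w^*%C = towX phi theta w, towY phi theta w^*%C = - towY phi theta w &
      expi (towZ phi w^*%C) = expi (towZ phi w)].
Proof.
move=> wP; have [X0 Y0 I0 Z0] := fac_neq0 wP.
have [eX eY eI eZ] := fac_conj wP.
have cabsJ z : cabs z^*%C = cabs z by rewrite !cabsE; case: z => a b; rewrite /nsq /= sqrrN.
have lnV' z : z != 0 -> ln (cabs z^-1) = - ln (cabs z).
  by move=> z0; rewrite cabsV lnV// posrE cabs_gt0.
split.
- by rewrite !towXE eX cabsJ.
- by rewrite !towYE eY eI !cabsJ !lnV'//; ring.
rewrite !expi_towZ ?punctures_conj// eZ -!/(dir _).
rewrite dir_conj dirV; rewrite /dir; set z := facZ phi w.
have c0 : cabs z != 0 by rewrite lt0r_neq0// cabs_gt0.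
rewrite invf_div conjcM conjc_inv conjc_real.
have zz : z * z^*%C = (cabs z)%:C * (cabs z)%:C.
  by rewrite -rmorphM -expr2 cabs_sqr /nsq; case: (z) => a b; apply: complex_eqP => /=; ring.
have z0 : z^*%C != 0 by rewrite conjc_eq0.
have c0' : (cabs z)%:C != 0 :> R[i] by rewrite fmorph_eq0.
by apply: (mulIf z0); rewrite mulfVK// mulrAC zz mulfK.
Qed.

Lemma punctured_someP w : D (Some w) <-> w \notin punctures phi.
Proof.
split=> [Dw|wP]; first by apply/negP => wP; apply: Dw; exists w.
by move=> [z zP [zw]]; move: wP; rewrite -zw (zP : z \in punctures phi).
Qed.

Lemma punctured_none : D None.
Proof. by move=> [z _ //]. Qed.

Lemma zero_notin_punctures : 0 \notin punctures phi.
Proof. by rewrite !inE !(eq_sym 0) !oppr_eq0 !(negPf (expi_neq0 _)) !(negPf (neq0Ci _)). Qed.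

Lemma chart0_preimage : chart0 @^-1` D = regular phi.
Proof. by apply/seteqP; split=> u /=; rewrite /chart0 => /punctured_someP. Qed.

Lemma chart_infty_preimage : chart_infty @^-1` D = regular phi.
Proof.
apply/seteqP; split=> u; rewrite /= /chart_infty /regular /=.
  have [->|u0] := eqVneq (cplx u) 0; first by rewrite zero_notin_punctures.
  by move/punctured_someP; rewrite punctures_inv.
case: (eqVneq (cplx u) 0) => [_ _|u0 uP]; first exact: punctured_none.
by apply/punctured_someP; rewrite punctures_inv.
Qed.

Lemma facZ0 : facZ phi 0 = 1.
Proof.
rewrite /facZ /facY /facI !add0r; have i0 := neq0Ci R[i].
have p0 := expi_neq0 phi; have q0 := expi_neq0 (- phi).
by field; rewrite i0 p0 q0.
Qed.

Lemma tow0 : [/\ towX phi theta 0 = 0, towY phi theta 0 = 0 & expi (towZ phi 0) = 1 :> R[i]].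
Proof.
have p0 := expi_neq0 phi; have q0 := expi_neq0 (- phi); have i0 := neq0Ci R[i].
have cabs1 : cabs (1 : R[i]) = 1 by rewrite -expi0 cabs_expi.
have X1 : facX phi 0 = 1 by rewrite /facX !add0r; field; rewrite p0 q0.
have Y1 : facY phi 0 = 1 by rewrite /facY !add0r; field; rewrite p0 q0.
have I1 : facI (0 : R[i]) = -1 by rewrite /facI !add0r; field.
split.
- by rewrite towXE X1 cabs1 ln1 mulr0.
- by rewrite towYE Y1 I1 cabs_opp cabs1 ln1 mulr0 addr0.
by rewrite expi_towZ ?zero_notin_punctures// facZ0 cabs1 divr1.
Qed.

Lemma expi_lift w0 u : w0 \notin punctures phi -> lift_dom phi w0 u ->
  expi (towZ phi w0 + atan (complex.Im (localS phi w0 u) / complex.Re (localS phi w0 u))) =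
  expi (towZ phi (cplx u)).
Proof.
move=> w0P [uP Su]; rewrite expiD expi_atan// !expi_towZ// -!/(dir _) -dirM /localS.
by have [_ _ _ Z0] := fac_neq0 w0P; rewrite mulrCA mulfV// mulr1.
Qed.

Lemma chart0_lift w0 u : w0 \notin punctures phi -> lift_dom phi w0 u ->
  towG (chart0 u) = qproj (lift phi theta 1 (towZ phi w0) w0 u).
Proof.
move=> w0P uw; apply/qprojP; rewrite /towF /lift !cx_vec3 !cy_vec3 !cz_vec3 !mul1r.
by rewrite expi_lift.
Qed.

Lemma chart_infty_lift w0 u : w0 \notin punctures phi -> lift_dom phi w0 u ->
  towG (chart_infty u) = qproj (lift phi theta (-1) (pi - towZ phi w0) w0 u).
Proof.
move=> w0P uw; have [uP _] := uw; rewrite /chart_infty.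
have eZ : expi (pi - towZ phi w0 - atan (complex.Im (localS phi w0 u) / complex.Re (localS phi w0 u)))
    = - (expi (towZ phi (cplx u)))^-1.
  by rewrite -addrA -opprD expiD expi_pi expiN expi_lift// mulN1r.
have [u0|u0] := eqVneq (cplx u) 0; apply/qprojP;
    rewrite /towF /lift !cx_vec3 !cy_vec3 !cz_vec3 !mulN1r eZ.
  by rewrite u0; have [-> -> ->] := tow0; rewrite oppr0 invr1 expi_pi.
by have [-> -> ->] := tow_inv u0 uP.
Qed.

Lemma chart_cover (o : rsphere R) : D o ->
  exists2 u, regular phi u & o = chart0 u \/ o = chart_infty u.
Proof.
case: o => [w /punctured_someP wP|_].
  exists (uncplx w); first by rewrite /regular /= uncplxK.
  by left; rewrite /chart0 uncplxK.
exists (uncplx 0); first by rewrite /regular /= uncplxK zero_notin_punctures.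
by right; rewrite /chart_infty uncplxK eqxx.
Qed.

Lemma chart_continuous (S : topologicalType) (G : S -> quot3 R) (e : 'rV[R]_2 -> S)
    (V : set 'rV[R]_2) f v0 :
  (forall V', open V' -> open (e @` V')) -> open V -> V v0 ->
  (forall v, V v -> G (e v) = qproj (f v)) -> {for v0, continuous f} ->
  {for e v0, continuous G}.
Proof.
move=> eopen oV Vv0 Gf cf N; rewrite /= Gf// => nN.
have cqf : {for v0, continuous (qproj \o f)}.
  by apply: continuous_comp; [exact: cf|exact: qproj_continuous].
have : nbhs v0 (V `&` (qproj \o f) @^-1` N).
  by apply: filterI; [exact: open_nbhs_nbhs|exact: cqf].
rewrite nbhsE => -[V' [oV' V'v0] V'N].
have : nbhs (e v0) (e @` V') by apply: open_nbhs_nbhs; split; [exact: eopen|exists v0].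
by apply: filterS => _ [v /V'N[Vv Nv] <-]; rewrite /= Gf.
Qed.

Lemma lift_continuous a b w0 u : w0 \notin punctures phi -> lift_dom phi w0 u ->
  {for u, continuous (lift phi theta a b w0)}.
Proof.
move=> w0P uw; apply: continuous_coordP => j.
exact: rdiff_continuous (weierstrass_lift theta a b w0P j uw).
Qed.

Lemma towG_continuous o : D o -> {for o, continuous towG}.
Proof.
move=> /chart_cover[u uP [->|->]].
  apply: (chart_continuous (@chart0_open R) (open_lift_dom uP) (lift_dom_center uP)).
    by move=> v; exact: chart0_lift.
  by apply: lift_continuous => //; exact: lift_dom_center.
apply: (chart_continuous (@chart_infty_open R) (open_lift_dom uP) (lift_dom_center uP)).
  by move=> v; exact: chart_infty_lift.
by apply: lift_continuous => //; exact: lift_dom_center.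
Qed.

Lemma towG_inj : {in D &, injective towG}.
Proof.
(* A finite point sharing X = Y = 0 with infinity must be 0, but e^(iZ) is 1 there and -1 at
   infinity. *)
have none_some w : w \notin punctures phi -> towG None <> towG (Some w).
  move=> wP /qprojP; rewrite /towF !cx_vec3 !cy_vec3 !cz_vec3 => -[eY eX eZ].
  have [X0 Y0 Z0] := tow0.
  have [ex ey] : stx 0 = stx w /\ sty 0 = sty w.
    by apply: (tow_inj hphi htheta zero_notin_punctures wP); rewrite ?X0 ?Y0.
  have [w0|[_ /eqP//]] := stereo_eq ex ey.
  move: eZ; rewrite -w0 Z0 expi_pi => /esym/eqP; rewrite -addr_eq0 -mulr2n.
  by rewrite mulrn_eq0 oner_eq0.
move=> [w1|] [w2|] /set_mem // D1 /set_mem D2; last 1 first.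
- by move=> /none_some; case; apply/punctured_someP.
- move/punctured_someP : D1 => P1; move/punctured_someP : D2 => P2.
  move=> /qprojP; rewrite /towF !cx_vec3 !cy_vec3 !cz_vec3 => -[eY eX eZ].
  have [ex ey] := tow_inj hphi htheta P1 P2 eX eY.
  have [->//|[w2E w10]] := stereo_eq ex ey.
  congr Some; have Pc : w1^*%C \notin punctures phi by rewrite punctures_conj.
  have wc0 : w1^*%C != 0 by rewrite conjc_eq0.
  have [_ _ eZ'] := tow_inv wc0 Pc.
  move: eZ; rewrite w2E eZ'; have [_ _ ->] := tow_conj P1.
  rewrite expi_towZ// -/(dir _) => eZ.
  (* The two inverse points have directions d and -1/d; equality gives d^2 = -1, so R^2 = -|R|^2 and
     Re R = 0. Then |w1| = 1 and the inversion fixes w1. *)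
  have Re0 : complex.Re (facZ phi w1) = 0.
    have := dir_neq0 (_ : facZ phi w1 != 0); have [_ _ _ Z0] := fac_neq0 P1.
    move=> /(_ Z0) d0; move/(congr1 (fun z => z * dir (facZ phi w1))): eZ; rewrite mulNr mulVf//.
    have c0 : cabs (facZ phi w1) != 0 by rewrite lt0r_neq0// cabs_gt0.
    have c0' : (cabs (facZ phi w1))%:C != 0 :> R[i] by rewrite fmorph_eq0.
    rewrite /dir mulf_div => /(canRL (divfK (mulf_neq0 c0' c0'))).
    have -> : (cabs (facZ phi w1))%:C * (cabs (facZ phi w1))%:C = (nsq (facZ phi w1))%:C :> R[i].
      by rewrite -cabs_sqr expr2 rmorphM.
    rewrite /nsq; case: (facZ phi w1) => a b /= [e1 e2].
    have : a * a = 0 by move: e1; rewrite !expr2; lra.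
    by move/eqP; rewrite mulf_eq0 orbb => /eqP.
  have n1 := Re_facZ_eq0 hphi P1 Re0.
  rewrite complex_invE.
  have -> : nsq w1^*%C = nsq w1 by case: (w1) => a b; rewrite /nsq /= sqrrN.
  by rewrite n1; case: (w1) => a b /=; rewrite !divr1 opprK.
by move=> /esym /none_some; case; apply/punctured_someP.
Qed.

End TowerMap.

Ltac try_indices tac :=
  first [tac 0%N | tac 1%N | tac 2%N | tac 3%N | tac 4%N | tac 5%N].

(** Each required inequality is an instance of [neq] for some pair of indices among six, found by
    trial. *)
Ltac distinct_punctures neq :=
  rewrite /= ?andbT; repeat (apply/andP; split);
  try_indices ltac:(fun i => try_indices ltac:(fun j => exact (neq i j isT isT isT))).

(** * Logarithmic blow-up at the punctures *)

Section TowerEnds.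
Context {R : realType} (phi theta : R) (hphi : 0 < phi < pi / 2) (htheta : 0 < theta < pi / 2)
  (hcos : cos theta = 1 - sin phi).
Implicit Types (w z : R[i]).
Let p : R[i] := expi phi.
Let q : R[i] := expi (- phi).

Definition lcabs (z : R[i]) (w : Cplane R) : R := ln (cabs (w - z)).

Lemma towX_lcabs w : w \notin punctures phi -> towX phi theta w =
  sin theta * (lcabs (- p) w + lcabs (- q) w - lcabs p w - lcabs q w).
Proof.
move=> /puncturesP[w1 w2 w3 w4 [w5 w6]]; rewrite /towX /lcabs !opprK -/p -/q.
rewrite ln_div ?posrE ?mulr_gt0 ?cabs_gt0// !lnM ?posrE ?cabs_gt0//.
by congr (_ * _); ring.
Qed.

Lemma towY_lcabs w : w \notin punctures phi -> towY phi theta w =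
  lcabs 'i w - lcabs (- 'i) w +
  cos theta * (lcabs p w + lcabs (- q) w - lcabs (- p) w - lcabs q w).
Proof.
move=> /puncturesP[w1 w2 w3 w4 [w5 w6]]; rewrite /towY /lcabs !opprK -/p -/q.
rewrite !ln_div ?posrE ?mulr_gt0 ?cabs_gt0// !lnM ?posrE ?cabs_gt0//.
by congr (_ + _ * _); ring.
Qed.

Lemma lcabs_continuous (z w : Cplane R) : w != z -> {for w, continuous (lcabs z)}.
Proof.
move=> wz; have c0 : 0 < cabs (w - z) by rewrite cabs_gt0 subr_eq0.
have cB : {for w, continuous (fun v : Cplane R => v - z)}.
  move=> P /nbhs_cabs[e e0 zP]; apply/nbhs_cabs; exists e => // v vw; apply: zP => /=.
  by rewrite opprB addrA subrK.
have cc : {for w, continuous (fun v : Cplane R => cabs (v - z) : R)}.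
  by apply: (continuous_comp cB); exact: cabs_continuous.
by apply: (continuous_comp cc); exact: continuous_ln.
Qed.

Lemma near_regular (z : Cplane R) : \forall w \near z, w \in punctures phi -> w = z.
Proof.
elim: (punctures phi) => [|a l IH]; first exact: (filterS _ filterT).
have [za|za] := eqVneq z a.
  by apply: filterS IH => w wl; rewrite inE -za => /predU1P[|/wl].
apply: filterS (filterI IH (nbhs_neq za)) => w [wl wa]; rewrite inE (negPf wa); exact: wl.
Qed.

(* Real combinations of the logarithms [lcabs z], given by (coefficient, z). *)
Definition lsum (ks : seq (R * Cplane R)) (w : Cplane R) : R :=
  \sum_(kz <- ks) kz.1 * lcabs kz.2 w.

Lemma lsum_continuous ks (z : Cplane R) : all (fun kz => z != kz.2) ks ->
  {for z, continuous (lsum ks)}.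
Proof.
elim: ks => [_|[k a] ks IH /= /andP[za zks]].
  rewrite (_ : lsum [::] = fun=> 0); first exact: cst_continuous.
  by apply/funext => w; rewrite /lsum big_nil.
have h1 : {for z, continuous (fun w : Cplane R => k * lcabs a w : R)}.
  by apply: (@continuousM R (Cplane R)); [exact: cst_continuous|exact: lcabs_continuous].
rewrite (_ : lsum _ = (fun w => k * lcabs a w) \+ lsum ks).
  exact: (@continuousD R R (Cplane R) _ _ z h1 (IH zks)).
by apply/funext => w; rewrite /lsum big_cons.
Qed.

Lemma log_blowup (z : Cplane R) (k : R) (g : Cplane R -> R) : k != 0 -> {for z, continuous g} ->
  forall N, \forall w \near z, w != z -> N < `|k * lcabs z w + g w|.
Proof.
move=> k0 cg N; set M := `|g z| + 1.
have k1 : 0 < `|k| by rewrite normr_gt0.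
have n1 : \forall w \near z, `|g w| < M.
  have : {for z, continuous (fun w : Cplane R => `|g w| : R)} by apply: continuous_comp; [exact: cg|exact: norm_continuous].
  by move=> /(_ [set x | x < M]); apply; apply: open_nbhs_nbhs; split; [exact: open_lt|rewrite /= /M ltrDl].
have n2 : \forall w \near z, w != z -> lcabs z w < - ((`|N| + M) / `|k|).
  (* Within this radius |k| times the logarithm outweighs |N| plus the bound M on g. *)
  apply/nbhs_cabs; exists (expR (- ((`|N| + M) / `|k|))); first exact: expR_gt0.
  by move=> w wz w0; rewrite /lcabs -ltr_expR lnK// posrE cabs_gt0 subr_eq0.
apply: filterS (filterI n1 n2) => w [gw lw] wz; have {}lw := lw wz.
apply: le_lt_trans (ler_norm N) _.
have : `|k * lcabs z w| <= `|k * lcabs z w + g w| + `|g w|.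
  by rewrite -[X in `|X| <= _](addrK (g w)) (le_trans (ler_normB _ _)).
have M0 : 0 <= M by rewrite addr_ge0.
have : `|N| + M < `|k * lcabs z w|.
  have l0 : lcabs z w < 0 by apply: lt_le_trans lw _; rewrite oppr_le0 divr_ge0// addr_ge0.
  by rewrite normrM (ltr0_norm l0) mulrC -ltr_pdivrMr// ltrNr.
lra.
Qed.

Lemma uniq_punctures : uniq (punctures phi).
Proof.
have [s0 c0] := sin_cos_pos hphi.
rewrite /punctures -complexiE /= !inE !negb_or /expi cosN sinN.
do ?(apply/andP; split) => //; apply/eqP => -[]; lra.
Qed.

Lemma sin_theta_gt0 : 0 < sin theta. Proof. exact: sin_gt0_pihalf. Qed.

Lemma cos_theta_gt0 : 0 < cos theta.
Proof.
by apply: cos_gt0_pihalf; case/andP: htheta => h ->; rewrite andbT; apply: lt_trans h; rewrite oppr_lt0 divr_gt0 ?pi_gt0.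
Qed.

Lemma puncture_neq i j : (i < 6)%N -> (j < 6)%N -> i != j ->
  (punctures phi)`_i != (punctures phi)`_j.
Proof. by move=> i6 j6 ij; rewrite nth_uniq ?uniq_punctures. Qed.

(** X stays finite at +-i, where Y has a logarithm with coefficient +-1; at the other four punctures
    X has one with coefficient +-sin theta. *)
Lemma tow_blowup (z : Cplane R) : z \in punctures phi -> forall N,
  \forall w \near z, w \notin punctures phi -> N < `|towX phi theta w| + `|towY phi theta w|.
Proof.
move=> zP N; have St := sin_theta_gt0; have S0 : sin theta != 0 by rewrite lt0r_neq0.
have S0' : - sin theta != 0 by rewrite oppr_eq0.
have wz w : w \notin punctures phi -> w != z by apply: contraNneq => ->.
have viaX k ks : k != 0 -> all (fun kz => z != kz.2) ks ->
    (forall w, w \notin punctures phi -> towX phi theta w = k * lcabs z w + lsum ks w) ->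
    \forall w \near z, w \notin punctures phi -> N < `|towX phi theta w| + `|towY phi theta w|.
  move=> k0 kz XE; apply: filterS (log_blowup k0 (lsum_continuous kz) N) => w wN wP.
  by rewrite XE// (lt_le_trans (wN (wz w wP)))// lerDl.
have viaY k ks : k != 0 -> all (fun kz => z != kz.2) ks ->
    (forall w, w \notin punctures phi -> towY phi theta w = k * lcabs z w + lsum ks w) ->
    \forall w \near z, w \notin punctures phi -> N < `|towX phi theta w| + `|towY phi theta w|.
  move=> k0 kz YE; apply: filterS (log_blowup k0 (lsum_continuous kz) N) => w wN wP.
  by rewrite [X in _ + `|X|]YE// (lt_le_trans (wN (wz w wP)))// lerDr.
move: zP; rewrite !inE -/p -/q => /or4P[/eqP zE|/eqP zE|/eqP zE|/or3P[/eqP zE|/eqP zE|/eqP zE]].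
- apply: (viaY 1 [:: (-1, - 'i); (cos theta, p); (cos theta, - q); (- cos theta, - p); (- cos theta, q)]) => [//||w wP].
    by rewrite zE; distinct_punctures puncture_neq.
  by rewrite zE towY_lcabs// /lsum !big_cons big_nil /=; ring.
- apply: (viaY (-1) [:: (1, 'i); (cos theta, p); (cos theta, - q); (- cos theta, - p); (- cos theta, q)]) => [||w wP].
  + by rewrite oppr_eq0.
  + by rewrite zE; distinct_punctures puncture_neq.
  by rewrite zE towY_lcabs// /lsum !big_cons big_nil /=; ring.
- apply: (viaX (- sin theta) [:: (sin theta, - p); (sin theta, - q); (- sin theta, q)]) => [//||w wP]; first by rewrite zE; distinct_punctures puncture_neq.
  by rewrite zE towX_lcabs// /lsum !big_cons big_nil /=; ring.
- apply: (viaX (sin theta) [:: (- sin theta, p); (sin theta, - q); (- sin theta, q)]) => [//||w wP]; first by rewrite zE; distinct_punctures puncture_neq.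
  by rewrite zE towX_lcabs// /lsum !big_cons big_nil /=; ring.
- apply: (viaX (- sin theta) [:: (- sin theta, p); (sin theta, - q); (sin theta, - p)]) => [//||w wP]; first by rewrite zE; distinct_punctures puncture_neq.
  by rewrite zE towX_lcabs// /lsum !big_cons big_nil /=; ring.
apply: (viaX (sin theta) [:: (- sin theta, p); (- sin theta, q); (sin theta, - p)]) => [//||w wP]; first by rewrite zE; distinct_punctures puncture_neq.
by rewrite zE towX_lcabs// /lsum !big_cons big_nil /=; ring.
Qed.

End TowerEnds.

Section Distance.
Context {R : realType}.
Implicit Types (a : 'rV[R]_3) (d : R).

Lemma enorm_ge0 a : 0 <= enorm a.
Proof. exact: sqrtr_ge0. Qed.

(** A displacement along the y-axis bounds the distance to an oblique plane well enough for limits,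
    so no perpendicular foot is computed. *)
Lemma dist_to_bounds a (P : 'rV[R]_3 -> Prop) d :
  P (vec3 (cx a) (cy a - d) (cz a)) -> 0 <= dist_to (qproj a) (locus P) <= `|d|.
Proof.
move=> Pad; rewrite /dist_to; set E := [set _ | _].
have Ed : E `|d|.
  exists a, (vec3 (cx a) (cy a - d) (cz a)); split=> //; first by exists (vec3 (cx a) (cy a - d) (cz a)).
  rewrite /enorm /dot sum3 !mxE /= -sqrtr_sqr; congr Num.sqrt.
  by rewrite /cx /cy /cz; ring.
have lbE : lbound E 0 by move=> _ [? [? [_ _ ->]]]; exact: enorm_ge0.
apply/andP; split; first by apply: lb_le_inf => //; exists `|d|.
by apply: ge_inf => //; exists 0.
Qed.

End Distance.

(** * Embedding, minimality, symmetry and ends of the surface *)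

Section TowerSurface.
Context {R : realType} (phi theta : R) (hphi : 0 < phi < pi / 2) (htheta : 0 < theta < pi / 2)
  (hcos : cos theta = 1 - sin phi).
Implicit Types (u v : 'rV[R]_2) (w : R[i]).
Let p : R[i] := expi phi.
Let q : R[i] := expi (- phi).
Let D : set (rsphere R) := punctured_sphere phi.
Let G := @towG R phi theta.
Let M : set (quot3 R) := G @` D.

(** The exhaustion function for properness; the z direction is periodic and cannot escape. *)
Definition qsize (o : quot3 R) : R := `|qx o| + `|qy o|.

Lemma qsize_continuous : continuous qsize.
Proof.
have cx : continuous (fun o : quot3 R => `|qx o| : R).
  by move=> o; apply: continuous_comp; [exact: qx_continuous|exact: norm_continuous].
have cy : continuous (fun o : quot3 R => `|qy o| : R).
  by move=> o; apply: continuous_comp; [exact: qy_continuous|exact: norm_continuous].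
move=> o; exact: (@continuousD R R (quot3 R) _ _ o (cx o) (cy o)).
Qed.

Lemma qsize_towG w : qsize (G (Some w)) = `|towX phi theta w| + `|towY phi theta w|.
Proof. by rewrite /qsize /G /towG /towF qxE qyE cx_vec3 cy_vec3 addrC. Qed.

Lemma not_punctured (o : rsphere R) : ~ D o -> exists2 z, z \in punctures phi & o = Some z.
Proof.
case: o => [z nD|/(_ (@punctured_none R phi))//]; exists z => //.
by apply/negPn/negP => /punctured_someP.
Qed.

Lemma towG_proper (o : rsphere R) N : ~ D o -> \forall v \near o, D v -> N < qsize (G v).
Proof.
move=> /not_punctured[z zP ->].
suff : \forall w \near (z : Cplane R), D (Some w) -> N < qsize (G (Some w)) by [].
apply: filterS (tow_blowup hphi htheta zP N) => w wN /punctured_someP wP.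
by rewrite qsize_towG; exact: wN.
Qed.

Lemma towG_embedding : top_embedding D G.
Proof.
apply: (proper_top_embedding (rho := qsize)).
- exact: one_point_compactification_compact.
- exact: qsize_continuous.
- by move=> o; exact: towG_continuous.
- exact: towG_proper.
- exact: quot3_hausdorff.
exact: towG_inj.
Qed.

Lemma towG_smooth_immersion0 : smooth_immersion (chart0 @^-1` D) (G \o chart0).
Proof.
rewrite chart0_preimage => u uP; exists (lift_dom phi (cplx u)), (lift phi theta 1 (towZ phi (cplx u)) (cplx u)).
split; first exact: open_lift_dom.
- exact: lift_dom_center.
- by move=> v [].
- by split; [exact: smooth_lift|apply: immersed_lift; rewrite ?mulr1].
by move=> v uv; exact: chart0_lift.
Qed.

Lemma towG_smooth_immersion_infty : smooth_immersion (chart_infty @^-1` D) (G \o chart_infty).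
Proof.
rewrite chart_infty_preimage => u uP.
exists (lift_dom phi (cplx u)), (lift phi theta (-1) (pi - towZ phi (cplx u)) (cplx u)).
split; first exact: open_lift_dom.
- exact: lift_dom_center.
- by move=> v [].
- by split; [exact: smooth_lift|apply: immersed_lift; rewrite ?mulrNN ?mulr1].
by move=> v uv; exact: chart_infty_lift.
Qed.

Lemma towG_minimal : minimal_surface M.
Proof.
move=> _ [x xD <-].
have [u uP xu] := chart_cover xD.
have [e [a [b [aa ocont einj eopen [eD eo]]]]] : exists e : 'rV[R]_2 -> rsphere R, exists a b : R,
    [/\ a * a = 1, forall v, lift_dom phi (cplx u) v -> G (e v) = qproj (lift phi theta a b (cplx u) v),
        injective e, forall V', open V' -> open (e @` V') &
        (e @` lift_dom phi (cplx u) `<=` D) /\ x = e u].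
  case: xu => ->.
    exists chart0, 1, (towZ phi (cplx u)); split; rewrite ?mulr1//.
    - by move=> v; exact: chart0_lift.
    - exact: chart0_inj.
    - exact: chart0_open.
    by split=> // _ [v [vP _] <-]; move: vP; rewrite -chart0_preimage.
  exists chart_infty, (-1), (pi - towZ phi (cplx u)); split; rewrite ?mulrNN ?mulr1//.
  - by move=> v; exact: chart_infty_lift.
  - exact: chart_infty_inj.
  - exact: chart_infty_open.
  by split=> // _ [v [vP _] <-]; move: vP; rewrite -chart_infty_preimage.
have [emb [W [oW WE]]] := chart_embedding towG_embedding einj eopen (open_lift_dom uP) eD ocont
  (fun v => @lift_continuous R phi theta a b (cplx u) v uP).
exists (lift_dom phi (cplx u)), (lift phi theta a b (cplx u)); split.
- by split; [exact: open_lift_dom|exact: smooth_lift].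
- by split; [exact: immersed_lift|exact: emb].
- by exists W.
- by exists u; [exact: lift_dom_center|rewrite eo /= ocont//; exact: lift_dom_center].
by move=> v; exact: mean_curvature_lift.
Qed.

Lemma vec3_eta (r : 'rV[R]_3) : vec3 (cx r) (cy r) (cz r) = r.
Proof.
apply/rowP => -[[|[|[|//]]] jlt]; rewrite !mxE /=;
  by [congr (r 0 _); exact/val_inj].
Qed.

Lemma towG_reflection : invariant_reflection_x M.
Proof.
have half (r : 'rV[R]_3) : M (qproj r) -> M (qproj (vec3 (- cx r) (cy r) (cz r))).
  move=> [[w|] Do /qprojP]; rewrite /towF !cx_vec3 !cy_vec3 !cz_vec3 => -[e1 e2 e3].
    have /punctured_someP wP := Do; have [X Y Z] := tow_conj theta wP.
    exists (Some w^*%C); first by apply/punctured_someP; rewrite punctures_conj.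
    by apply/qprojP; rewrite /towF !cx_vec3 !cy_vec3 !cz_vec3 X Y Z e1 e2 e3.
  by exists None => //; apply/qprojP; rewrite !cx_vec3 !cy_vec3 !cz_vec3 -e1 -e2 e3 oppr0.
move=> r; split=> [/half|]; last exact: half.
by rewrite cx_vec3 cy_vec3 cz_vec3 opprK vec3_eta.
Qed.

(** Ordered to match the asymptotic planes: +-i for y = 0, +-q for slope tan theta, +-p for slope
    -tan theta. *)
Definition ends : seq (rsphere R) :=
  [:: Some 'i; Some (- 'i); Some q; Some (- q); Some p; Some (- p)].

Lemma perm_ends : perm_eq ends (map Some (punctures phi) : seq (rsphere R)).
Proof.
rewrite /ends /punctures /= -/p -/q !perm_cons.
by apply/permP => a /=; lia.
Qed.

Lemma uniq_ends : uniq ends.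
Proof.
rewrite (perm_uniq perm_ends) map_inj_uniq; first exact: uniq_punctures.
by move=> x y [].
Qed.

Lemma compl_ends : ~` [set` ends] = D.
Proof.
rewrite /D /punctured_sphere; congr (~` _); apply/seteqP; split=> o /=.
  by rewrite (perm_mem perm_ends) => /mapP[w wP ->]; exists w.
by move=> [w wP <-]; rewrite (perm_mem perm_ends); apply/mapP; exists w.
Qed.

Lemma towG_genus0 : genus0_with_ends M 6.
Proof.
exists ends, G; rewrite compl_ends; split=> //; first exact: uniq_ends.
exact: towG_embedding.
Qed.

(** [lsum ks] is the combination of X and Y whose logarithm at z has cancelled. It is continuous at
    z with value beta, so the y-shift that carries the point into the plane tends to 0. *)
Lemma tow_end (z : Cplane R) (ks : seq (R * Cplane R)) (beta : R) (P : 'rV[R]_3 -> Prop) :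
  z \in punctures phi -> all (fun kz => z != kz.2) ks -> lsum ks z = beta ->
  (forall w, w \notin punctures phi ->
    P (vec3 (towY phi theta w) (towX phi theta w - (lsum ks w - beta)) (towZ phi w))) ->
  end_asymptotic G (Some z) (locus P).
Proof.
move=> zP zks zb PP.
have near_reg (Q : set (rsphere R)) : (\forall w \near z, w \notin punctures phi -> Q (Some w)) ->
    \forall w \near (Some z : rsphere R)^', Q w.
  move=> nQ; rewrite /dnbhs /within /=.
  suff : \forall w \near z, (Some w : rsphere R) != Some z -> Q (Some w) by [].
  apply: filterS (filterI nQ (near_regular phi z)) => w [wQ wz] wz'.
  by apply: wQ; apply/negP => /wz e; rewrite e eqxx in wz'.
split.
  move=> K cK; apply: near_reg.
  have cS : compact (qsize @` K).
    by apply: continuous_compact cK; apply: continuous_subspaceT; exact: qsize_continuous.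
  have [N [_ NK]] := compact_bounded cS.
  (* Compactness bounds [qsize] on K by every number above N, in particular by N + 1, which the
     blow-up exceeds. *)
  apply: filterS (tow_blowup hphi htheta zP (N + 1)) => w wN /wN {}wN KG.
  have := NK (N + 1) _ (qsize (G (Some w))); rewrite ltrDl ltr01 => /(_ isT).
  move=> /(_ (ex_intro2 _ _ _ KG erefl)) /=.
  by rewrite qsize_towG ger0_norm ?addr_ge0// leNgt wN.
apply/cvgrPdist_lt => e e0; apply: near_reg.
have c0 : nbhs (lsum ks z) [set x | `|x - beta| < e].
  rewrite zb; apply/nbhs_normP; exists e => //= x /=.
  by rewrite -opprB normrN.
apply: (filterS _ (lsum_continuous zks c0 : nbhs z _)) => w /= we wP.
have := PP w wP; rewrite -[X in P X]/(vec3 _ _ _).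
have := @dist_to_bounds R (towF phi theta w) P (lsum ks w - beta).
rewrite /towF cx_vec3 cy_vec3 cz_vec3 => db Pw; have /andP[d0 d1] := db Pw.
by rewrite sub0r normrN ger0_norm// (le_lt_trans d1).
Qed.

Lemma fac_1 : 1 \notin punctures phi /\ facZ phi 1 = 'i.
Proof.
have [s0 c0] := sin_cos_pos hphi.
have oneP : 1 \notin punctures phi.
  rewrite !inE !negb_or /expi cosN sinN -complexiE.
  do ?(apply/andP; split) => //; apply/eqP => -[]; lra.
split=> //; have [w1 w2 w3 w4 [w5 w6]] := puncturesP oneP.
have i0 := neq0Ci R[i]; have ii : 'i * 'i = -1 :> R[i] by rewrite -expr2 sqrCi.
have Y1 : facY phi 1 = -1.
  rewrite /facY; apply: (mulIf (mulf_neq0 w2 w3)); rewrite mulfVK ?mulf_neq0//.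
  have pq := expi_mulN phi; move: (expi phi) (expi (- phi)) pq => x y xy.
  transitivity ((1 - x * y) + (y - x)); first by ring.
  by rewrite xy; transitivity (- ((1 - x * y) + (x - y))); [rewrite xy|]; ring.
have I1 : facI (1 : R[i]) = - 'i.
  rewrite /facI; apply: (mulIf w6); rewrite mulfVK//.
  transitivity (- 'i - 'i * 'i : R[i]); last by ring.
  by rewrite ii; ring.
rewrite /facZ Y1 I1; apply: (mulIf (_ : - 'i != 0 :> R[i])); first by rewrite oppr_eq0.
by rewrite mulfVK ?oppr_eq0// mulrN ii.
Qed.

Lemma facZ_opp w : w \notin punctures phi -> facZ phi (- w) = (facZ phi w)^-1.
Proof.
move=> wP; have [w1 w2 w3 w4 [w5 w6]] := puncturesP wP.
have opp (x y : R[i]) : - x - y = - (x + y) by rewrite opprD.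
have opp' (x y : R[i]) : - x + y = - (x - y) by rewrite opprB addrC.
rewrite /facZ /facY /facI !opp !opp' !mulrNN !invrN !mulrNN.
by field; rewrite w1 w2 w3 w4 w5 w6.
Qed.

(** The point is the image of w = 1, where R = i. A point with Y = 0 shares X and Y with its
    conjugate, so w is real; height pi/2 gives Re R = 0, so |w| = 1. Finally w = -1 is excluded
    because R(-1) = 1/R(1) = -i. *)
Lemma tower_point : exists o : quot3 R,
  M `&` locus (fun r => cx r = 0 /\ cz r = pi / 2) = [set o] /\ locus (fun r => 0 < cy r) o.
Proof.
have [s0 c0] := sin_cos_pos hphi; have st := sin_theta_gt0 htheta.
have [oneP Z1] := fac_1; have i0 := neq0Ci R[i].
have dir_i : dir 'i = 'i :> R[i] by rewrite imag_expi dir_expi.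
have one_conj : (1 : R[i])^*%C = 1 by rewrite conjc1.
have Y0 : towY phi theta 1 = 0.
  have [_ + _] := tow_conj theta oneP; rewrite one_conj => e.
  lra.
have X0 : 0 < towX phi theta 1.
  have [-> _] := tow_stereo theta oneP.
  have -> : stx (1 : R[i]) = 1 by rewrite /stx /nsq /= expr0n/= addr0 expr1n; field.
  have -> : sty (1 : R[i]) = 0 by rewrite /sty /= mulr0 mul0r.
  rewrite mul1r mul0r addr0 subr0 mulr_gt0// mulr_gt0 ?invr_gt0//.
  have c1 : cos phi < 1 by have := cos2Dsin2 phi; nra.
  have : lr (0 : R) < lr (cos phi) by apply: lr_lt; rewrite ?oppr_lt0.
  by rewrite {1}/lr addr0 subr0 divr1 ln1 => l0; rewrite addr_gt0.
have G1 : G (Some 1) = qproj (vec3 0 (towX phi theta 1) (pi / 2)).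
  apply/qprojP; rewrite /towF !cx_vec3 !cy_vec3 !cz_vec3 Y0 -imag_expi.
  by rewrite expi_towZ// -/(dir _) Z1 dir_i.
exists (G (Some 1)); split; last first.
  by exists (vec3 0 (towX phi theta 1) (pi / 2)); rewrite ?G1//= cy_vec3.
apply/seteqP; split=> [t [[x xD <-] [r [rx rz]]]|_ ->]; last first.
  split; first by exists (Some 1) => //; apply/punctured_someP.
  by exists (vec3 0 (towX phi theta 1) (pi / 2)); rewrite ?G1//= cx_vec3 cz_vec3.
case: x xD => [w /punctured_someP wP|_] /qprojP; last first.
  rewrite !cz_vec3 rz -imag_expi expi_pi => -[_ _ e].
  have := congr1 (@complex.Re R) e; rewrite -complexiE /= => /eqP.
  by rewrite eq_sym oppr_eq0 oner_eq0.
rewrite /towF !cx_vec3 !cy_vec3 !cz_vec3 rx rz -imag_expi => -[/esym wY _ /esym wZ].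
rewrite expi_towZ// -/(dir _) in wZ.
have Im0 : complex.Im w = 0.
  have wcP : w^*%C \notin punctures phi by rewrite punctures_conj.
  have [eX eY _] := tow_conj theta wP.
  have [_] : stx w^*%C = stx w /\ sty w^*%C = sty w.
    by apply: (tow_inj hphi htheta wcP wP); rewrite ?eX// eY wY oppr0.
  have n0 : 1 + nsq w != 0 by rewrite gt_eqF// ltr_pwDl// nsq_ge0.
  rewrite /sty; have -> : nsq w^*%C = nsq w by case: (w) => a b; rewrite /nsq /= sqrrN.
  move/(mulIf (_ : (1 + nsq w)^-1 != 0)); rewrite invr_eq0 => /(_ n0).
  by case: (w) => a b /=; lra.
have zE : facZ phi w = dir (facZ phi w) * (cabs (facZ phi w))%:C.
  have [_ _ _ Z0] := fac_neq0 wP.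
  by rewrite mulfVK// fmorph_eq0 lt0r_neq0// cabs_gt0.
have Re0 : complex.Re (facZ phi w) = 0 by rewrite zE wZ -complexiE /=; ring.
have := Re_facZ_eq0 hphi wP Re0.
rewrite /nsq Im0 expr0n/= addr0 => /eqP; rewrite sqrf_eq1 => /orP[/eqP e|/eqP e].
  by congr (G (Some _)); apply: complex_eqP.
have wE : w = - 1 by apply: complex_eqP; rewrite //= oppr0.
exfalso; move: wZ; rewrite wE facZ_opp// Z1 dirV dir_i => /(congr1 (fun z => z * 'i)).
rewrite mulVf// -expr2 sqrCi => /eqP; rewrite -addr_eq0 -mulr2n mulrn_eq0 oner_eq0//.
Qed.

(** The logarithms are of squared distances between punctures: 4 cos^2 phi and 4 sin^2 phi between
    +-p and +-q, and 2 -+ 2 sin phi to +-i. *)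
Lemma end_value :
  2 * sin theta * (2^-1 * ln (4 * cos phi ^+ 2) - 2^-1 * ln (4 * sin phi ^+ 2)) +
  tan theta * (2^-1 * ln (2 - 2 * sin phi) - 2^-1 * ln (2 + 2 * sin phi)) = btow theta.
Proof.
have [s0 c0] := sin_cos_pos hphi; have ct := cos_theta_gt0 htheta.
have s1 : 0 < 1 - sin phi by rewrite -hcos.
have s2 : 0 < 1 + sin phi by rewrite addr_gt0.
rewrite /btow hcos.
have -> : 4 * cos phi ^+ 2 = 4 * ((1 + sin phi) * (1 - sin phi)).
  by rewrite cos2sin2; ring.
have -> : 2 - 2 * sin phi = 2 * (1 - sin phi) by ring.
have -> : 2 + 2 * sin phi = 2 * (1 + sin phi) by ring.
have -> : 2 * (1 - sin phi)^-1 - 1 = (1 + sin phi) / (1 - sin phi) by field; rewrite gt_eqF.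
have -> : (1 - sin phi)^-1 - 1 = sin phi / (1 - sin phi) by field; rewrite gt_eqF.
rewrite expr2 !lnM ?posrE ?mulr_gt0 ?invr_gt0// !lnV ?posrE//.
by field.
Qed.

Lemma tower_ends : exists w1 w2 w3 w4 w5 w6 : rsphere R,
  [/\ uniq [:: w1; w2; w3; w4; w5; w6],
      ~` [set` [:: w1; w2; w3; w4; w5; w6]] = D,
      end_asymptotic G w1 (locus (fun p => cy p = 0)) /\
      end_asymptotic G w2 (locus (fun p => cy p = 0)),
      end_asymptotic G w3 (locus (fun p => cy p = btow theta + cx p * tan theta)) /\
      end_asymptotic G w4 (locus (fun p => cy p = - btow theta + cx p * tan theta)) &
      end_asymptotic G w5 (locus (fun p => cy p = btow theta - cx p * tan theta)) /\
      end_asymptotic G w6 (locus (fun p => cy p = - btow theta - cx p * tan theta))].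
Proof.
exists (Some 'i), (Some (- 'i)), (Some q), (Some (- q)), (Some p), (Some (- p)).
have ct := cos_theta_gt0 htheta; have ct0 : cos theta != 0 by rewrite gt_eqF.
(* This makes the logarithms cancel: X - Y tan theta has none at +-q, and X + Y tan theta has none
   at +-p. *)
have tanE : tan theta * cos theta = sin theta by rewrite /tan mulfVK.
have cs := cos2Dsin2 phi.
have l_val (a z : R[i]) (n : R) : nsq (z - a) = n -> lcabs a z = 2^-1 * ln n.
  by move=> <-; rewrite /lcabs ln_cabs.
have neq := puncture_neq hphi.
split; [exact: uniq_ends|exact: compl_ends|split|split|split].
- apply: (@tow_end _ [:: (sin theta, - p); (sin theta, - q); (- sin theta, p); (- sin theta, q)] 0).
  + by rewrite !inE eqxx.
  + by distinct_punctures neq.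
  + { rewrite /lsum !big_cons big_nil /= (l_val (- p) 'i (2 + 2 * sin phi)) ?(l_val (- q) 'i (2 - 2 * sin phi))
      ?(l_val p 'i (2 - 2 * sin phi)) ?(l_val q 'i (2 + 2 * sin phi)); first by ring.
    all: rewrite /nsq /p /q /expi ?cosN ?sinN -complexiE /=; nra. }
  by move=> w wP; rewrite cy_vec3 towX_lcabs// /lsum !big_cons big_nil /=; ring.
- apply: (@tow_end _ [:: (sin theta, - p); (sin theta, - q); (- sin theta, p); (- sin theta, q)] 0).
  + by rewrite !inE eqxx ?orbT.
  + by distinct_punctures neq.
  + { rewrite /lsum !big_cons big_nil /= (l_val (- p) (- 'i) (2 - 2 * sin phi)) ?(l_val (- q) (- 'i) (2 + 2 * sin phi))
      ?(l_val p (- 'i) (2 + 2 * sin phi)) ?(l_val q (- 'i) (2 - 2 * sin phi)); first by ring.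
    all: rewrite /nsq /p /q /expi ?cosN ?sinN -complexiE /=; nra. }
  by move=> w wP; rewrite cy_vec3 towX_lcabs// /lsum !big_cons big_nil /=; ring.
- apply: (@tow_end _ [:: (2 * sin theta, - p); (- (2 * sin theta), p); (- tan theta, 'i); (tan theta, - 'i)] (btow theta)).
  + by rewrite !inE eqxx ?orbT.
  + by distinct_punctures neq.
  + { rewrite /lsum !big_cons big_nil /= (l_val (- p) q (4 * cos phi ^+ 2)) ?(l_val p q (4 * sin phi ^+ 2))
      ?(l_val 'i q (2 + 2 * sin phi)) ?(l_val (- 'i) q (2 - 2 * sin phi)).
    by rewrite -end_value; ring.
    all: rewrite /nsq /p /q /expi ?cosN ?sinN -?complexiE /=; nra. }
  move=> w wP; rewrite cy_vec3 cx_vec3 towX_lcabs// towY_lcabs// -tanE /lsum !big_cons big_nil /=; ring.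
- apply: (@tow_end _ [:: (2 * sin theta, - p); (- (2 * sin theta), p); (- tan theta, 'i); (tan theta, - 'i)] (- btow theta)).
  + by rewrite !inE eqxx ?orbT.
  + by distinct_punctures neq.
  + { rewrite /lsum !big_cons big_nil /= (l_val (- p) (- q) (4 * sin phi ^+ 2)) ?(l_val p (- q) (4 * cos phi ^+ 2))
      ?(l_val 'i (- q) (2 - 2 * sin phi)) ?(l_val (- 'i) (- q) (2 + 2 * sin phi)).
    by rewrite -end_value; ring.
    all: rewrite /nsq /p /q /expi ?cosN ?sinN -?complexiE /=; nra. }
  move=> w wP; rewrite cy_vec3 cx_vec3 towX_lcabs// towY_lcabs// -tanE /lsum !big_cons big_nil /=; ring.
- apply: (@tow_end _ [:: (2 * sin theta, - q); (- (2 * sin theta), q); (tan theta, 'i); (- tan theta, - 'i)] (btow theta)).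
  + by rewrite !inE eqxx ?orbT.
  + by distinct_punctures neq.
  + { rewrite /lsum !big_cons big_nil /= (l_val (- q) p (4 * cos phi ^+ 2)) ?(l_val q p (4 * sin phi ^+ 2))
      ?(l_val 'i p (2 - 2 * sin phi)) ?(l_val (- 'i) p (2 + 2 * sin phi)).
    by rewrite -end_value; ring.
    all: rewrite /nsq /p /q /expi ?cosN ?sinN -?complexiE /=; nra. }
  move=> w wP; rewrite cy_vec3 cx_vec3 towX_lcabs// towY_lcabs// -tanE /lsum !big_cons big_nil /=; ring.
apply: (@tow_end _ [:: (2 * sin theta, - q); (- (2 * sin theta), q); (tan theta, 'i); (- tan theta, - 'i)] (- btow theta)).
+ by rewrite !inE eqxx ?orbT.
+ by distinct_punctures neq.
+ { rewrite /lsum !big_cons big_nil /= (l_val (- q) (- p) (4 * sin phi ^+ 2)) ?(l_val q (- p) (4 * cos phi ^+ 2))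
    ?(l_val 'i (- p) (2 + 2 * sin phi)) ?(l_val (- 'i) (- p) (2 - 2 * sin phi)).
  by rewrite -end_value; ring.
  all: rewrite /nsq /p /q /expi ?cosN ?sinN -?complexiE /=; nra. }
by move=> w wP; rewrite cy_vec3 cx_vec3 towX_lcabs// towY_lcabs// -tanE /lsum !big_cons big_nil /=; ring.
Qed.

End TowerSurface.

(** * Arc length and intrinsic distance *)

Section ArcLength.
Context {R : realType}.
Implicit Types (c : R -> 'rV[R]_3) (r : 'rV[R]_3).

Lemma coord_le_enorm r j : `|r 0 j| <= enorm r.
Proof.
rewrite -sqrtr_sqr ler_wsqrtr// /dot (bigD1 j)//= -expr2 lerDl.
by rewrite sumr_ge0// => i _; rewrite -expr2 sqr_ge0.
Qed.

Lemma enorm_le_sum r : enorm r <= `|r 0 0| + `|r 0 1| + `|r 0 2%:R|.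
Proof.
rewrite /enorm /dot sum3 -(@ler_pXn2r _ 2)// ?nnegrE ?sqrtr_ge0 ?addr_ge0//.
rewrite sqr_sqrtr ?addr_ge0// -?expr2 ?sqr_ge0//.
rewrite -(real_normK (num_real (r 0 0))) -(real_normK (num_real (r 0 1))) -(real_normK (num_real (r 0 2%:R))).
have := normr_ge0 (r 0 0); have := normr_ge0 (r 0 1); have := normr_ge0 (r 0 2%:R).
move: (`|_|) (`|_|) (`|_|) => x y z x0 y0 z0; nra.
Qed.

Lemma enorm_continuous : continuous (@enorm R).
Proof.
have cj j : continuous (fun r : 'rV[R]_3 => r 0 j * r 0 j : R).
  by move=> r; apply: (@continuousM R 'rV[R]_3); exact: coord_continuous.
move=> r; apply: continuous_comp; last exact: sqrt_continuous.
rewrite (_ : (fun r => dot r r) = (fun r : 'rV[R]_3 => r 0 0 * r 0 0) \+ (fun r : 'rV[R]_3 => r 0 1 * r 0 1) \+ (fun r : 'rV[R]_3 => r 0 2%:R * r 0 2%:R)).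
  have c01 := @continuousD R R 'rV[R]_3 _ _ r (cj 0 r) (cj 1 r).
  exact: (@continuousD R R 'rV[R]_3 _ _ r c01 (cj 2%:R r)).
by apply/funext => x; rewrite /dot sum3.
Qed.

Lemma derive1_coord c j t : derivable c t 1 ->
  derivable (fun t => c t 0 j) t 1 /\ derive1 (fun t => c t 0 j) t = derive1 c t 0 j.
Proof.
move=> dc; split; first by move/derivable_mxP : (dc) => /(_ 0 j).
by rewrite !derive1E derive_mx// mxE.
Qed.

Lemma speed_measurable c : C1_curve c ->
  measurable_fun (`[0%R, 1%R]%classic : set (measurableTypeR R)) (fun t : R => (enorm (derive1 c t))%:E).
Proof.
move=> [dc cc]; apply/measurable_EFinP; apply: measurable_funTS.
apply: continuous_measurable_fun => t.
by apply: continuous_comp; [exact: cc|exact: enorm_continuous].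
Qed.

Lemma arc_length_ge0 c : (0 <= arc_length c)%E.
Proof. by apply: integral_ge0 => t _; rewrite lee_fin enorm_ge0. Qed.

(** A coordinate changes by the integral of its derivative, which the speed dominates. *)
Lemma arc_length_ge c j : C1_curve c -> (`|c 1 0 j - c 0 0 j|%:E <= arc_length c)%E.
Proof.
move=> /[dup] Cc [dc cc]; set F := fun t => c t 0 j.
have dF t : derivable F t 1 by have [] := derive1_coord j (dc t).
have FE t : derive1 F t = derive1 c t 0 j by have [] := derive1_coord j (dc t).
have cF : continuous (derive1 F).
  rewrite (_ : derive1 F = (fun r : 'rV[R]_3 => r 0 j) \o derive1 c); last by apply/funext => t; rewrite FE.
  by move=> t; apply: continuous_comp; [exact: cc|exact: coord_continuous].
have contF : continuous F by move=> t; apply: differentiable_continuous; apply/derivable1_diffP.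
have := @continuous_FTC2 R (derive1 F) F 0 1 ltr01.
have -> : ((F 1)%:E - (F 0)%:E)%E = (c 1 0 j - c 0 0 j)%:E by rewrite EFinB.
move=> FTC; rewrite -abse_EFin -FTC; last 3 first.
- exact: continuous_subspaceT.
- split; first by move=> t _; exact: dF.
  + exact/cvg_at_right_filter/contF.
  + exact/cvg_at_left_filter/contF.
- by [].
apply: le_trans (le_abse_integral _ _ _) _ => //.
  by apply/measurable_EFinP; apply: measurable_funTS; exact: continuous_measurable_fun.
apply: ge0_le_integral => //.
- apply: measurableT_comp => //; apply/measurable_EFinP; apply: measurable_funTS; exact: continuous_measurable_fun.
- exact: speed_measurable.
by move=> t _; rewrite abse_EFin lee_fin FE coord_le_enorm.
Qed.

Lemma arc_length_le c B : C1_curve c -> (forall t, enorm (derive1 c t) <= B) ->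
  (arc_length c <= B%:E)%E.
Proof.
move=> Cc cB; apply: (@le_trans _ _ (\int[lebesgue_measure]_(t in `[0%R, 1%R]) (cst B%:E t))%E).
  apply: ge0_le_integral => //.
  - by move=> t _; rewrite lee_fin enorm_ge0.
  - exact: speed_measurable.
  by move=> t _; rewrite lee_fin.
by rewrite integral_cst//= lebesgue_measure_itv/= lte_fin ltr01 oppr0 adde0 mule1.
Qed.

End ArcLength.

Section IntrinsicDistance.
Context {R : realType} (M : set (quot3 R)).
Local Notation d := (intrinsic_dist M).

Lemma intrinsic_ge0 a b : (0 <= d a b)%E.
Proof.
apply: le_ereal_inf_tmp => _ [s _ <-].
by apply: sume_ge0 => c _; exact: arc_length_ge0.
Qed.

Lemma path_in_cat a b e s1 s2 : path_in M a b s1 -> path_in M b e s2 -> path_in M a e (s1 ++ s2).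
Proof.
elim: s1 a => [a /= -> //|c s1 IH a /= [Cc cM c0 c1] be]; split=> //; exact: IH.
Qed.

(** The strict form provides actual paths to concatenate, with no case analysis on infinite
    distances. *)
Lemma intrinsic_lt_trans a b e (r1 r2 : R) :
  (d a b < r1%:E)%E -> (d b e < r2%:E)%E -> (d a e < (r1 + r2)%:E)%E.
Proof.
move=> /ereal_inf_lt[_ [s1 p1 <-] l1] /ereal_inf_lt[_ [s2 p2 <-] l2].
apply: (@le_lt_trans _ _ (\sum_(c <- s1 ++ s2) arc_length c)%E).
  by apply: ereal_inf_lbound; exists (s1 ++ s2) => //; exact: path_in_cat p1 p2.
by rewrite big_cat/= EFinD lteD.
Qed.

(** Successive arcs match only in the quotient, where x and y are still single-valued; hence these
    two coordinates are 1-Lipschitz. *)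
Lemma path_in_coord a b s :
  path_in M a b s -> (`|qx a - qx b|%:E <= \sum_(c <- s) arc_length c)%E /\
                     (`|qy a - qy b|%:E <= \sum_(c <- s) arc_length c)%E.
Proof.
elim: s a => [a /= ->|c s IH a /= [Cc cM <- /IH[h1 h2]]].
  by rewrite big_nil !subrr normr0.
rewrite !big_cons !qxE !qyE in h1 h2 *; split.
  apply: (@le_trans _ _ (`|cx (c 1) - cx (c 0)|%:E + `|cx (c 1) - qx b|%:E)%E).
    rewrite -EFinD lee_fin [`|_ (c 1) - _ (c 0)|]distrC.
    have -> : cx (c 0) - qx b = (cx (c 0) - cx (c 1)) + (cx (c 1) - qx b) by ring.
    exact: ler_normD.
  by apply: leeD h1; exact: arc_length_ge.
apply: (@le_trans _ _ (`|cy (c 1) - cy (c 0)|%:E + `|cy (c 1) - qy b|%:E)%E).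
  rewrite -EFinD lee_fin [`|_ (c 1) - _ (c 0)|]distrC.
  have -> : cy (c 0) - qy b = (cy (c 0) - cy (c 1)) + (cy (c 1) - qy b) by ring.
  exact: ler_normD.
by apply: leeD h2; exact: arc_length_ge.
Qed.

Lemma intrinsic_lt_coord a b (r : R) : (d a b < r%:E)%E ->
  `|qx a - qx b| < r /\ `|qy a - qy b| < r.
Proof.
move=> /ereal_inf_lt[_ [s /path_in_coord[h1 h2] <-] l].
by split; rewrite -lte_fin; apply: le_lt_trans l.
Qed.

End IntrinsicDistance.

(** * Short arcs inside a parametrised piece *)

Section LocalPaths.
Context {R : realType}.
Implicit Types (u v : 'rV[R]_2).

(* A C^1 reparametrization of [0,1] defined on the whole line, as arcs must be. *)
Definition ease (t : R) : R := 2^-1 * (1 - cos (pi * t)).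
Definition ease' (t : R) : R := 2^-1 * (sin (pi * t) * pi).

Lemma is_derive_ease t : is_derive t (1 : R) ease (ease' t).
Proof.
have h1 : is_derive t (1 : R) (fun t => pi * t) pi.
  by have := is_deriveZ pi (is_derive_id t (1 : R)); rewrite /GRing.scale /= mulr1.
have h2 := is_derive1_comp (is_derive_cos (pi * t)) h1.
have h3 := is_deriveB (is_derive_cst (1 : R) t (1 : R)) h2.
have h4 := is_deriveZ (2^-1 : R) h3.
by apply: is_derive_eq h4 _; rewrite /ease' /GRing.scale /= sub0r mulNr opprK.
Qed.

Lemma ease'_continuous : continuous ease'.
Proof.
have h (t : R) : {for t, continuous (fun t : R => pi * t : R)}.
  by apply: (@continuousM R R); [exact: cst_continuous|].
have h2 (t : R) : {for t, continuous (fun t : R => sin (pi * t) : R)}.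
  by apply: (continuous_comp (h t)); exact: continuous_sin.
have h3 (t : R) : {for t, continuous (fun t : R => sin (pi * t) * pi : R)}.
  by apply: (@continuousM R R); [exact: h2|exact: cst_continuous].
move=> t; exact: (@continuousM R R (cst 2^-1) _ t (@cst_continuous _ _ _ t) (h3 t)).
Qed.

Lemma ease0 : ease 0 = 0. Proof. by rewrite /ease mulr0 cos0 subrr mulr0. Qed.

Lemma ease1 : ease 1 = 1. Proof. by rewrite /ease mulr1 cospi opprK mulVf. Qed.

Lemma ease_range t : 0 <= ease t <= 1.
Proof. by rewrite /ease; have := cos_le1 (pi * t); have := cos_geN1 (pi * t); lra. Qed.

Lemma ease'_bound t : `|ease' t| <= 2.
Proof.
rewrite /ease' !normrM ger0_norm ?invr_ge0// [`|pi|]ger0_norm ?pi_ge0//.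
have := sin_max (pi * t); have := pihalf_lt2 R; have := pi_ge0 R; have := normr_ge0 (sin (pi * t)).
by move: `|_| => x; nra.
Qed.

Context (U : set 'rV[R]_2) (F : 'rV[R]_2 -> 'rV[R]_3) (H : 'I_3 -> 'rV[R]_2 -> R[i])
  (oU : open U) (wF : weierstrass U F H) (kH : forall j, cdiffk 1 U (H j)).

Definition segment_curve v d (t : R) : 'rV[R]_2 := v + ease t *: d.

Lemma is_diff_segment v d t :
  is_diff t (segment_curve v d) (fun h : R => (h * ease' t) *: d).
Proof.
have de : is_diff t ease ( *:%R^~ (ease' t)).
  have dease := is_derive_ease t.
  have dp : differentiable ease t by apply/derivable1_diffP; exact: ex_derive.
  by apply: DiffDef => //; rewrite diff1E// derive1E derive_val.
have ds := is_diff_comp de (is_diff_scalel (ease t) d).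
by apply: is_diff_eq (is_diffD (is_diff_cst v t) ds) _; apply/funext => h; rewrite fctE /= add0r.
Qed.

Lemma is_derive_lift_segment v d t j : U (segment_curve v d t) ->
  derivable (fun t => F (segment_curve v d t) 0 j) t 1 /\
  derive1 (fun t => F (segment_curve v d t) 0 j) t = ease' t * lin2 (H j (segment_curve v d t)) d.
Proof.
move=> Ut; have dF : is_diff (segment_curve v d t) (fun w => F w 0 j) _ := wF j Ut.
have [dc dcE] := is_diff_comp (is_diff_segment v d t) dF.
split; first exact/derivable1_diffP.
have := congr1 (fun g => g (1 : R)) dcE; rewrite /= diff1E// /GRing.scale /= !mul1r => ->.
by rewrite /lin2 !mxE; ring.
Qed.

Lemma lift_segment_C1 v d : (forall t, U (segment_curve v d t)) ->
  C1_curve (F \o segment_curve v d) /\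
  forall t, derive1 (F \o segment_curve v d) t =
    \row_j (ease' t * lin2 (H j (segment_curve v d t)) d).
Proof.
move=> Uc; have dF t : derivable (F \o segment_curve v d) t 1.
  by apply/derivable_mxP => i j; rewrite ord1; case: (is_derive_lift_segment j (Uc t)).
have dE t : derive1 (F \o segment_curve v d) t =
    \row_j (ease' t * lin2 (H j (segment_curve v d t)) d).
  rewrite derive1E derive_mx//; apply/matrixP => i j; rewrite !mxE ord1.
  by have [_ <-] := is_derive_lift_segment j (Uc t); rewrite derive1E.
suff cE : continuous (fun t => \row_j (ease' t * lin2 (H j (segment_curve v d t)) d) : 'rV[R]_3).
  by split; last exact: dE; split; [exact: dF|move: cE; have <- := funext dE].
move=> t; apply: continuous_coordP => j.
rewrite (_ : (fun t => _) = fun t => ease' t * lin2 (H j (segment_curve v d t)) d); last first.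
  by apply/funext => x; rewrite mxE.
apply: (@continuousM R R); first exact: ease'_continuous.
have [h' dh _] := kH j; have [dh1 dh2] := dh _ (Uc t).
have cs : {for t, continuous (segment_curve v d)}.
  by have [ds _] := is_diff_segment v d t; exact: differentiable_continuous.
have c1 : {for t, continuous (fun t => complex.Re (H j (segment_curve v d t)) * d 0 0 : R)}.
  by apply: (@continuousM R R); [exact: (continuous_comp cs (rdiff_continuous dh1))|exact: cst_continuous].
have c2 : {for t, continuous (fun t => complex.Im (H j (segment_curve v d t)) * d 0 1 : R)}.
  by apply: (@continuousM R R); [exact: (continuous_comp cs (rdiff_continuous dh2))|exact: cst_continuous].
exact: (@continuousB R R R _ _ t c1 c2).
Qed.

Lemma short_arc u0 (e : R) : U u0 -> 0 < e -> \forall v \near u0, exists c,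
  [/\ C1_curve c, forall t, exists2 u, U u & c t = F u, c 0 = F v, c 1 = F u0 &
      (arc_length c < e%:E)%E].
Proof.
move=> Uu0 e0.
(* The extra 1 makes the bound strict at u0, so it persists nearby by continuity. *)
set B := 1 + \sum_j (`|complex.Re (H j u0)| + `|complex.Im (H j u0)|).
have HB j : `|complex.Re (H j u0)| + `|complex.Im (H j u0)| < B.
  rewrite /B (bigD1 j)//= ltr_pwDl// lerDl sumr_ge0// => i _; exact: addr_ge0.
have B0 : 0 < B by apply: le_lt_trans (HB 0); rewrite addr_ge0.
have nB j : \forall v \near u0, `|complex.Re (H j v)| + `|complex.Im (H j v)| < B.
  have [h' dh _] := kH j; have [dh1 dh2] := dh _ Uu0.
  have c1 : {for u0, continuous (fun v => `|complex.Re (H j v)| : R)}.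
    by apply: (continuous_comp (rdiff_continuous dh1)); exact: norm_continuous.
  have c2 : {for u0, continuous (fun v => `|complex.Im (H j v)| : R)}.
    by apply: (continuous_comp (rdiff_continuous dh2)); exact: norm_continuous.
  have nb : nbhs (`|complex.Re (H j u0)| + `|complex.Im (H j u0)|) [set x : R | x < B].
    by apply: open_nbhs_nbhs; split; [exact: open_lt|exact: HB].
  exact: (@continuousD R R 'rV[R]_2 _ _ u0 c1 c2 _ nb).
have nU : nbhs u0 U by exact: open_nbhs_nbhs.
have : nbhs u0 (U `&` [set v | forall j, `|complex.Re (H j v)| + `|complex.Im (H j v)| < B]).
  apply: filterI nU _.
  exact: (@filter_forall _ _ (fun j v => `|complex.Re (H j v)| + `|complex.Im (H j v)| < B) (nbhs u0) _ nB).
move=> /nbhs_normP[/= r r0 rU].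
(* The length is at most 6 B |d|: three coordinates, each with speed at most 2 B |d|, the 2 being
   the bound on [ease']. *)
have s0 : 0 < Num.min r (e / (6 * B + 1)).
  by rewrite lt_min r0 divr_gt0// addr_gt0// mulr_gt0.
apply/nbhs_normP; exists (Num.min r (e / (6 * B + 1))) => //= v.
rewrite /ball_ /= lt_min => /andP[vr ve]; set d := u0 - v.
have seg_near t : `|u0 - segment_curve v d t| < r.
  apply: le_lt_trans vr; have -> : u0 - segment_curve v d t = (1 - ease t) *: d.
    by rewrite /segment_curve scalerBl scale1r opprD addrA.
  have /andP[e1 e2] := ease_range t.
  by rewrite normrZ ger0_norm ?subr_ge0// ler_piMl// lerBlDr lerDl.
have Useg t : U (segment_curve v d t) by have [] := rU _ (seg_near t).
have Hseg t j : `|complex.Re (H j (segment_curve v d t))| + `|complex.Im (H j (segment_curve v d t))| < B.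
  by have [_] := rU _ (seg_near t); exact.
have [C1 dE] := lift_segment_C1 Useg.
exists (F \o segment_curve v d); split=> //.
- by move=> t; exists (segment_curve v d t).
- by rewrite /= /segment_curve ease0 scale0r addr0.
- by rewrite /= /segment_curve ease1 scale1r addrC subrK.
apply: (@le_lt_trans _ _ (6 * B * `|d|)%:E).
  apply: arc_length_le => // t; apply: le_trans (enorm_le_sum _) _; rewrite dE !mxE.
  have comp j : `|ease' t * lin2 (H j (segment_curve v d t)) d| <= 2 * B * `|d|.
    rewrite normrM -mulrA ler_pM// ?ease'_bound//.
    rewrite /lin2 (le_trans (ler_normB _ _))// !normrM.
    have := norm_coord_le d 0; have := norm_coord_le d 1; have := Hseg t j.
    move: (normr_ge0 (complex.Re (H j (segment_curve v d t)))) (normr_ge0 (complex.Im (H j (segment_curve v d t)))).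
    move: `|complex.Re _| `|complex.Im _| (normr_ge0 d) => x y; move: `|d| (`|d 0 0|) (`|d 0 1|) => D d0 d1.
    move=> D0 x0 y0 xy l1 l0.
    apply: (@le_trans _ _ (x * D + y * D)); first by rewrite lerD// ler_wpM2l.
    by rewrite -mulrDl ler_wpM2r// ltW.
  have := comp 0; have := comp 1; have := comp 2%:R.
  lra.
rewrite lte_fin; have d0 := normr_ge0 d.
move: ve; rewrite ltr_pdivlMr ?addr_gt0// ?mulr_gt0// -/d => ve.
nra.
Qed.

End LocalPaths.

(** * Completeness *)

Section TowerComplete.
Context {R : realType} (phi theta : R) (hphi : 0 < phi < pi / 2) (htheta : 0 < theta < pi / 2)
  (hcos : cos theta = 1 - sin phi).
Let D : set (rsphere R) := punctured_sphere phi.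
Let G := @towG R phi theta.
Let M : set (quot3 R) := G @` D.

Lemma short_path (x : rsphere R) (e : R) : D x -> 0 < e ->
  \forall y \near x, (intrinsic_dist M (G y) (G x) < e%:E)%E.
Proof.
move=> xD e0; have [u uP xu] := chart_cover xD.
have [f [a [b [fopen fD fE ->]]]] : exists f : 'rV[R]_2 -> rsphere R, exists a b : R,
    [/\ forall V', open V' -> open (f @` V'), f @` lift_dom phi (cplx u) `<=` D,
        forall v, lift_dom phi (cplx u) v -> G (f v) = qproj (lift phi theta a b (cplx u) v) & x = f u].
  case: xu => ->.
    exists chart0, 1, (towZ phi (cplx u)); split=> //.
    - exact: chart0_open.
    - by move=> _ [v [vP _] <-]; move: vP; rewrite -chart0_preimage.
    by move=> v; exact: chart0_lift.
  exists chart_infty, (-1), (pi - towZ phi (cplx u)); split=> //.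
  - exact: chart_infty_open.
  - by move=> _ [v [vP _] <-]; move: vP; rewrite -chart_infty_preimage.
  by move=> v; exact: chart_infty_lift.
have kH j : cdiffk 1 (lift_dom phi (cplx u)) (towH phi theta a j).
  by apply: cdiffk_sub (cdiffk_towH phi theta a j 1) => v [].
have oV := open_lift_dom uP; have uV := lift_dom_center uP.
have := short_arc oV (weierstrass_lift theta a b uP) kH uV e0.
move=> sa; have : nbhs u (lift_dom phi (cplx u) `&` [set v | exists c,
  [/\ C1_curve c, forall t, exists2 u', lift_dom phi (cplx u) u' & c t = lift phi theta a b (cplx u) u',
      c 0 = lift phi theta a b (cplx u) v, c 1 = lift phi theta a b (cplx u) u &
      (arc_length c < e%:E)%E]]).
  by apply: filterI sa; exact: open_nbhs_nbhs.
rewrite nbhsE => -[V' [oV' V'u] V'sub].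
have : nbhs (f u) (f @` V') by apply: open_nbhs_nbhs; split; [exact: fopen|exists u].
apply: filterS => _ [v /V'sub[Vv [c [Cc cU c0 c1 lc]]] <-].
apply: le_lt_trans lc; apply: ereal_inf_lbound; exists [:: c]; last by rewrite big_seq1.
split=> //=.
- by move=> t _; have [w Vw ->] := cU t; exists (f w); [apply: fD; exists w|exact: fE].
- by rewrite c0 -fE.
by rewrite c1 -fE.
Qed.

Lemma towG_complete : complete_surface M.
Proof.
move=> s sM cauchy.
have /choice[x xP] : forall n, exists y, D y /\ G y = s n.
  by move=> n; have [y Dy <-] := sM n; exists y.
have [N0 N0P] := cauchy 1 ltr01.
(* Beyond N0 each of x and y moves by less than 1, hence the 2. *)
set K := qsize (s N0) + 2.
have bound n : (N0 <= n)%N -> qsize (s n) <= K.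
  move=> nN; have := N0P n N0 nN (leqnn _) => /intrinsic_lt_coord[dx dy].
  rewrite /K /qsize.
  have := ler_normD (qx (s n) - qx (s N0)) (qx (s N0)); rewrite subrK.
  have := ler_normD (qy (s n) - qy (s N0)) (qy (s N0)); rewrite subrK.
  lra.
have cE := proper_sublevel_compact (@one_point_compactification_compact _)
  (@qsize_continuous R) (@towG_continuous R phi theta) (towG_proper hphi htheta) (N := K).
have xE : (x @ \oo) [set y | D y /\ qsize (G y) <= K].
  exists N0 => // n /= nN; have [Dx Gx] := xP n; split=> //.
  by rewrite -/G Gx bound.
have [y [[Dy _] cy]] := cE _ _ xE.
exists (G y); first by exists y.
(* The cluster point supplies one late index n with s n within e/2 of G y; the Cauchy condition
   covers all other late indices. *)
have lim e : 0 < e -> \forall n \near \oo, (intrinsic_dist M (s n) (G y) < e%:E)%E.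
  move=> e0; have e20 : 0 < e / 2 by rewrite divr_gt0.
  have [N NP] := cauchy _ e20.
  have tail : (x @ \oo) (x @` [set n | (N <= n)%N]).
    by exists N => // n /= nN; exists n.
  have [_ [[n /= nN <-] near_y]] := cy _ _ tail (short_path Dy e20).
  exists N => // m /= mN; rewrite [e]splitr.
  apply: (intrinsic_lt_trans (NP m n mN nN)).
  by have [_ <-] := xP n.
move=> A A0; have : nbhs (0 : R) (fun r => A r%:E) by exact: A0.
move=> /nbhs_normP[/= e e0 eA].
apply: filterS (lim e e0) => n.
suff : (intrinsic_dist M (s n) (G y) < e%:E)%E -> A (intrinsic_dist M (s n) (G y)) by [].
have := intrinsic_ge0 M (s n) (G y).
case: (intrinsic_dist M (s n) (G y)) => [r|//|//].
rewrite lee_fin lte_fin => r0 re; apply: eA.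
by rewrite /= sub0r normrN ger0_norm.
Qed.

End TowerComplete.

Theorem propositionA8 (R : realType) (phi theta : R)
    (hphi : 0 < phi < pi / 2) (htheta : 0 < theta < pi / 2)
    (hcos : cos theta = 1 - sin phi) :
  exists G : rsphere R -> quot3 R,
    [/\ (forall w : R[i], w \notin punctures phi ->
           G (Some w) = qproj (towF phi theta w)),
        (forall w : R[i], punctured_disc phi w ->
           G (Some w) = qproj (towF phi theta w)),
        smooth_embedding (punctured_sphere phi) G &
        let M := G @` punctured_sphere phi in
        [/\
          [/\ minimal_surface M, complete_surface M & invariant_reflection_x M],
          genus0_with_ends M 6 /\
          (exists w1 w2 w3 w4 w5 w6 : rsphere R,
             [/\ uniq [:: w1; w2; w3; w4; w5; w6],
                 ~` [set` [:: w1; w2; w3; w4; w5; w6]] = punctured_sphere phi,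
                 end_asymptotic G w1 (locus (fun p => cy p = 0)) /\
                 end_asymptotic G w2 (locus (fun p => cy p = 0)),
                 end_asymptotic G w3
                   (locus (fun p => cy p = btow theta + cx p * tan theta)) /\
                 end_asymptotic G w4
                   (locus (fun p => cy p = - btow theta + cx p * tan theta)) &
                 end_asymptotic G w5
                   (locus (fun p => cy p = btow theta - cx p * tan theta)) /\
                 end_asymptotic G w6
                   (locus (fun p => cy p = - btow theta - cx p * tan theta))]) &
          (exists q : quot3 R,
             M `&` locus (fun p => cx p = 0 /\ cz p = pi / 2) = [set q] /\
             locus (fun p => 0 < cy p) q)]].
Proof.
exists (towG phi theta); split.
- by [].
- by move=> w [].
- by split; [exact: towG_embedding|exact: towG_smooth_immersion0|exact: towG_smooth_immersion_infty].
split; [split|split|exact: tower_point].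
- exact: towG_minimal.
- exact: towG_complete.
- exact: towG_reflection.
- exact: towG_genus0.
exact: tower_ends.
Qed.
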